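(* Let $\mathcal{M}$ be a family of probability measures on $\mathbb{R}$ such that (i) $\inf_{p\in\mathcal{M}}\mu_p>0$; (ii) $M_\tau:=\sup_{p\in\mathcal{M}}E_p[e^{\tau|X|}]<\infty$ for some $\tau>0$; (iii) each $p\in\mathcal{M}$ can be written as $p=(1-\lambda_p)\Phi_p+\lambda_p\Psi_p$ with $0\le\lambda_p<1$, where $\Phi_p,\Psi_p$ are probability measures and $\Phi_p$ has a density $\phi_p$; (iv) $\gamma:=\sup_{p\in\mathcal{M}}\lambda_p<1$; (v) there exists $T\in(0,\infty)$ such that $\phi_p\in C_0^2((-T,T))$ for all $p\in\mathcal{M}$ and $\sup_{p\in\mathcal{M}}\int_{-T}^T|\phi_p''(x)|\,dx<\infty$. Then for each $p\in\mathcal{M}$ the renewal measure decomposes as $N_p=Q_p+\bar N_p$, where $Q_p$ has a density $q_p$, $\sup_{p\in\mathcal{M}}\bar N_p(\mathbb{R})<\infty$, and there is $r_0>0$ such that for all $r\in(0,r_0)$, $$A_1:=\sup_{x>0,\,p\in\mathcal{M}}\{e^{rx}|q_p(x)-\mu_p^{-1}|\}+\sup_{x>0,\,p\in\mathcal{M}}\{e^{rx}q_p(-x)\}<\infty,$$ $$A_2:=\sup_{x>0,\,p\in\mathcal{M}}\{e^{rx}\bar N_p((-\infty,-x]\cup[x,\infty))\}<\infty.$$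
   Context: For a probability measure $p$ on $\mathbb{R}$, $\mu_p$ denotes its mean, $E_p$ denotes expectation when $X\sim p$, $p^{n*}$ is the $n$-fold convolution of $p$ with $p^{0*}:=\delta_0$, and $N_p=\sum_{n=0}^\infty p^{n*}$ is the associated renewal measure. $C_0^2((-T,T))$ denotes twice continuously differentiable functions with compact support in $(-T,T)$. *)

(* Defs.v *)
From HB Require Import structures.
From mathcomp Require Import all_boot all_order all_algebra.
From mathcomp Require Import all_classical all_reals all_analysis.
Set Implicit Arguments. Unset Strict Implicit. Unset Printing Implicit Defensive.
Import Order.TTheory GRing.Theory Num.Theory.
Import numFieldNormedType.Exports.
Local Open Scope classical_set_scope.
Local Open Scope ring_scope.

Fixpoint convpow (R : realType) (p : probability R R) (n : nat) (A : set R) : \bar R :=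
  match n with
  | 0 => \d_(0 : R) A
  | n'.+1 => (\int[p]_x convpow p n' [set y : R | A (y + x)%R])%E
  end.

Definition renewal (R : realType) (p : probability R R) (A : set R) : \bar R :=
  (\sum_(0 <= n <oo) convpow p n A)%E.

Definition pmean (R : realType) (p : probability R R) : R :=
  fine (\int[p]_x (x%:E))%E.

Definition C02 (R : realType) (T : R) (f : R -> R) : Prop :=
  (forall x, derivable f x 1) /\ (forall x, derivable (derive1 f) x 1) /\
  continuous (derive1n 2 f) /\
  exists K : set R, [/\ compact K, K `<=` `](- T), T[ & forall x, ~ K x -> f x = 0].

(* Main.v *)
(* Write p = nu + f dx with nu = lambda Psi, of mass at most gamma < 1, and
   f = (1 - lambda) phi. Expanding every power of p around the powers of nu
   splits N into the geometric series of nu, which is Nbar, and a density q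
   solving the renewal equations q = F + p * q and F = f + nu * F. Exponential
   moments give F(y) = O(exp(- s |y|)) and, since the drift is bounded below,
   q(y) = O(exp(s y)).
   The decay of q(y) - q(y') as y and y' grow is a coupling argument, carried out
   on the renewal equation. When y and y' are far apart only the larger one is
   moved by a jump, and the drift brings the two together. When they are close
   both jump: p dominates a multiple of the uniform law on an interval whose
   position depends on p but whose length does not, so the two uniform jumps can
   be coupled so that the distance changes by +-dl or vanishes, the remaining
   parts of the jumps being equal. A suitable weight of the distance contracts.
   Hence q has a limit at infinity, at exponential speed, and the behaviour of
   its Laplace transform at 0 shows that this limit is 1 / mu. *)
Require Import Defs.
From HB Require Import structures.
From mathcomp Require Import all_boot all_order all_algebra.
From mathcomp Require Import all_classical all_reals all_analysis.
From mathcomp Require Import measurable_realfun ring lra.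
Import Order.TTheory GRing.Theory Num.Theory.
Import numFieldNormedType.Exports.
Local Open Scope classical_set_scope.
Local Open Scope ring_scope.

(** * Convolution with measures and densities *)

Section mconv.
Context {R : realType}.
Notation leb := (@lebesgue_measure R).
Local Open Scope ereal_scope.

(** Everything must be uniform over the family, so each constant is built from the common bounds
    alone and never from [p]. Powers of a measure are treated as operators on functions, so no
    convolution of measures is constructed. Likewise no coupled process is built: the coupling is an
    inequality between integrals, in which one piece of the law of the jump is rearranged. The
    obstacle is that the only a priori bound on [q y - q y'] grows with the position, while the
    wanted bound decays. The contraction is therefore proved for every prefactor [E] whose logarithm
    has slope at most [s]: decaying and growing exponentials both pass through it, and the growing
    one is multiplied by [1 - e0] each time. At moderate distance the coupled distance moves by
    [+dl] or [-dl] with equal chances, which gains nothing on average; a strictly concave weight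
    turns these fluctuations into a gain, and an exponential weight turns the drift into a gain at
    large distance. The bound on the second derivatives enters through a Lipschitz constant: a peak
    of the density keeps half its height on an interval of fixed length. *)

Definition mconv (m : set R -> \bar R) (g : R -> \bar R) (y : R) : \bar R :=
  \int[m]_z g (y - z)%R.

Definition fconv (h g : R -> \bar R) (y : R) : \bar R :=
  \int[leb]_z (h z * g (y - z)%R).

Implicit Types g h : R -> \bar R.

Lemma measurable_subr2 : measurable_fun [set: R * R] (fun u : R * R => (u.1 - u.2)%R).
Proof. exact: measurable_funB. Qed.

Lemma measurable_shiftN (y : R) : measurable_fun [set: R] (fun z : R => (y - z)%R).
Proof. exact: measurable_funB. Qed.

Lemma measurable_shift (y : R) : measurable_fun [set: R] (fun z : R => (z - y)%R).
Proof. exact: measurable_funB. Qed.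

Lemma measurable_shifted g (y : R) : measurable_fun setT g ->
  measurable_fun setT (fun z : R => g (y - z)%R).
Proof. move=> mg; exact: (measurableT_comp mg (measurable_shiftN y)). Qed.

Lemma mconv_ge0 (m : {measure set R -> \bar R}) g y :
  (forall x, 0 <= g x) -> 0 <= mconv m g y.
Proof. by move=> g0; apply: integral_ge0. Qed.

Lemma fconv_ge0 h g y :
  (forall x, 0 <= h x) -> (forall x, 0 <= g x) -> 0 <= fconv h g y.
Proof. by move=> h0 g0; apply: integral_ge0 => z _; rewrite mule_ge0. Qed.

Lemma measurable_mconv (m : {sigma_finite_measure set R -> \bar R}) g :
  measurable_fun setT g -> (forall x, 0 <= g x) -> measurable_fun setT (mconv m g).
Proof.
move=> mg g0.
apply: (measurable_fun_fubini_tonelli_F (m2 := m)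
  (fun u : R * R => g (u.1 - u.2)%R)) => //.
exact: (measurableT_comp mg measurable_subr2).
Qed.

Lemma measurable_fconv h g :
  measurable_fun setT h -> (forall x, 0 <= h x) ->
  measurable_fun setT g -> (forall x, 0 <= g x) -> measurable_fun setT (fconv h g).
Proof.
move=> mh h0 mg g0.
apply: (measurable_fun_fubini_tonelli_F (m2 := leb)
  (fun u : R * R => h u.2 * g (u.1 - u.2)%R)) => //.
  apply: emeasurable_funM; first exact: (measurableT_comp mh measurable_snd).
  exact: (measurableT_comp mg measurable_subr2).
by move=> u; rewrite mule_ge0.
Qed.

Lemma le_mconv (m : {measure set R -> \bar R}) g1 g2 y :
  measurable_fun setT g1 -> measurable_fun setT g2 -> (forall x, 0 <= g1 x) ->
  (forall x, g1 x <= g2 x) -> mconv m g1 y <= mconv m g2 y.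
Proof.
move=> m1 m2 g0 g12; apply: ge0_le_integral => //; exact: measurable_shifted.
Qed.

Lemma mconvD (m : {measure set R -> \bar R}) g1 g2 y :
  measurable_fun setT g1 -> measurable_fun setT g2 ->
  (forall x, 0 <= g1 x) -> (forall x, 0 <= g2 x) ->
  mconv m (fun x => g1 x + g2 x) y = mconv m g1 y + mconv m g2 y.
Proof.
move=> m1 m2 g10 g20; rewrite /mconv ge0_integralD//; exact: measurable_shifted.
Qed.

Lemma mconv_nneseries (m : {measure set R -> \bar R}) (g : nat -> R -> \bar R) y :
  (forall n, measurable_fun setT (g n)) -> (forall n x, 0 <= g n x) ->
  mconv m (fun x => \sum_(n <oo) g n x) y = \sum_(n <oo) mconv m (g n) y.
Proof.
move=> mg g0; rewrite /mconv integral_nneseries// => n; exact: (measurable_shifted (g n) y (mg n)).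
Qed.

Lemma fconv_nneseriesl (h : nat -> R -> \bar R) g y :
  (forall n, measurable_fun setT (h n)) -> (forall n x, 0 <= h n x) ->
  measurable_fun setT g -> (forall x, 0 <= g x) -> (forall x, g x \is a fin_num) ->
  fconv (fun x => \sum_(n <oo) h n x) g y = \sum_(n <oo) fconv (h n) g y.
Proof.
move=> mh h0 mg g0 gf; rewrite /fconv -integral_nneseries//; last 2 first.
- by move=> n; exact: (emeasurable_funM (mh n) (measurable_shifted g y mg)).
- by move=> n x _; rewrite mule_ge0.
apply: eq_integral => z _; rewrite muleC -(fineK (gf _)) -nneseriesZl//.
by apply: eq_eseriesr => n _; rewrite muleC.
Qed.

Lemma fconvDl h1 h2 g y :
  measurable_fun setT h1 -> measurable_fun setT h2 ->
  (forall x, 0 <= h1 x) -> (forall x, 0 <= h2 x) ->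
  measurable_fun setT g -> (forall x, 0 <= g x) ->
  fconv (fun x => h1 x + h2 x) g y = fconv h1 g y + fconv h2 g y.
Proof.
move=> m1 m2 h10 h20 mg g0; have mgs := measurable_shifted g y mg.
rewrite /fconv -ge0_integralD//; last 4 first.
- by move=> x _; rewrite mule_ge0.
- exact: emeasurable_funM.
- by move=> x _; rewrite mule_ge0.
- exact: emeasurable_funM.
by apply: eq_integral => z _; rewrite ge0_muleDl.
Qed.

Lemma mconv_fconvr (m : {sigma_finite_measure set R -> \bar R}) h g y :
  measurable_fun setT h -> (forall x, 0 <= h x) ->
  measurable_fun setT g -> (forall x, 0 <= g x) ->
  mconv m (fconv h g) y = fconv h (mconv m g) y.
Proof.
move=> mh h0 mg g0; rewrite /mconv /fconv.
rewrite (fubini_tonelli (m1 := m) (m2 := leb)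
  (fun u : R * R => h u.2 * g (y - u.1 - u.2)%R)).
- apply: eq_integral => w _; rewrite -ge0_integralZl//; last exact: measurable_shifted.
  by apply: eq_integral => z _; rewrite addrAC.
- apply: emeasurable_funM; first exact: (measurableT_comp mh measurable_snd).
  apply: (measurableT_comp mg); apply: measurable_funB; last exact: measurable_snd.
  exact: measurable_funB.
- by move=> u; rewrite mule_ge0.
Qed.

(** The pushforward gives each []u, v]] its length, and this characterizes Lebesgue measure. *)
Lemma lebesgue_measure_shift (a : R) (A : set (measurableTypeR R)) : measurable A ->
  leb A = pushforward leb (fun z : measurableTypeR R => (z - a)%R : measurableTypeR R) A.
Proof.
move=> mA.
have ms : @measurable_fun _ _ (measurableTypeR R) (measurableTypeR R) setT
  (fun z : R => (z - a)%R) := measurable_shift a.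
apply: lebesgue_measure_unique => // _ [[u v]] _ <-.
transitivity (leb `](u + a)%R, (v + a)%R]%classic).
  rewrite !lebesgue_measure_itv/= !lte_fin ltrD2r.
  by case: ifP => // _; congr EFin; lra.
congr (leb _); apply/seteqP; split => z /=; rewrite !in_itv/= => /andP[? ?];
  by apply/andP; split; lra.
Qed.

Lemma ge0_integral_shift g (a : R) :
  measurable_fun setT g -> (forall x, 0 <= g x) ->
  \int[leb]_x g (x - a)%R = \int[leb]_x g x.
Proof.
move=> mg g0.
have ms : @measurable_fun _ _ (measurableTypeR R) (measurableTypeR R) setT
  (fun z : R => (z - a)%R) := measurable_shift a.
rewrite -[in LHS](preimage_setT (fun z : measurableTypeR R => (z - a)%R : measurableTypeR R)).
rewrite -[LHS](@ge0_integral_pushforward _ _ _ _ _ _ ms leb setT g)//.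
by apply: eq_measure_integral => //= A mA _; exact/esym/lebesgue_measure_shift.
Qed.

(** The inner integral is translated by [z] before Tonelli, so that [z] leaves [g] and enters [h].
    With [mconv_fconvr], a measure can be moved from one factor of a convolution to the other. *)
Lemma mconv_fconvl (m : {sigma_finite_measure set R -> \bar R}) h g y :
  measurable_fun setT h -> (forall x, 0 <= h x) ->
  measurable_fun setT g -> (forall x, 0 <= g x) ->
  mconv m (fconv h g) y = fconv (mconv m h) g y.
Proof.
move=> mh h0 mg g0; rewrite /mconv /fconv.
have mh1 (z : R) : measurable_fun setT (fun w : R => h (w - z)%R).
  exact: (measurableT_comp mh (measurable_shift z)).
transitivity (\int[m]_(z in setT) \int[leb]_(w in setT) (h ((w : R) - (z : R))%R * g (y - (w : R))%R)).
  apply: eq_integral => z _.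
  rewrite -(ge0_integral_shift (fun w => h w * g (y - z - w)%R) z).
  - by apply: eq_integral => w _; congr (_ * g _); lra.
  - by apply: emeasurable_funM => //; exact: measurable_shifted.
  - by move=> w; rewrite mule_ge0.
rewrite (fubini_tonelli (m1 := m) (m2 := leb)
  (fun u : R * R => h (u.2 - u.1)%R * g (y - u.2)%R)).
- apply: eq_integral => w _; rewrite muleC -ge0_integralZl//.
  + by apply: eq_integral => z _; rewrite muleC.
  + exact: measurable_shifted.
- apply: emeasurable_funM.
    apply: (measurableT_comp mh).
    exact: measurable_funB.
  apply: (measurableT_comp mg); apply: measurable_funB; last exact: measurable_snd.
  exact: measurable_cst.
- by move=> u; rewrite mule_ge0.
Qed.

End mconv.

Section density.
Context {R : realType}.
Notation leb := (@lebesgue_measure R).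
Local Open Scope ereal_scope.

Import HBNNSimple.

(** The splitting of [p], given on sets, is carried to integrals by the usual ladder: indicators,
    simple functions, monotone limits. *)
Lemma ge0_integral_density (p nu : {measure set R -> \bar R}) (f : R -> R) (g : R -> \bar R) :
  measurable_fun setT f -> (forall x, 0 <= f x)%R ->
  (forall A, measurable A -> p A = nu A + \int[leb]_(x in A) (f x)%:E) ->
  measurable_fun setT g -> (forall x, 0 <= g x) ->
  \int[p]_x g x = \int[nu]_x g x + \int[leb]_x ((f x)%:E * g x).
Proof.
move=> mf' f0' pE mg g0.
have mf : measurable_fun setT (fun x => (f x)%:E) by exact/measurable_EFinP.
have f0 x : 0 <= (f x)%:E by rewrite lee_fin.
have indicE A : measurable A -> \int[p]_x (\1_A x)%:E =
    \int[nu]_x (\1_A x)%:E + \int[leb]_x ((f x)%:E * (\1_A x)%:E).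
  move=> mA; rewrite !integral_indic// !setIT pE//; congr (_ + _).
  rewrite integral_mkcond/=; apply: eq_integral => x _; rewrite patchE indicE.
  by case: ifPn; rewrite ?mule1 ?mule0.
have mi (r : R) (h : {nnsfun R >-> R}) :
    measurable_fun setT (fun x : R => (r * \1_(h @^-1` [set r]) x)%:E).
  by apply/measurable_EFinP; do 2 apply/measurableT_comp => //.
have i0 (r : R) (h : {nnsfun R >-> R}) (x : R) : 0 <= (r * \1_(h @^-1` [set r]) x)%:E.
  by rewrite EFinM nnfun_muleindic_ge0.
have nnsfunE (h : {nnsfun R >-> R}) : \int[p]_x (h x)%:E =
    \int[nu]_x (h x)%:E + \int[leb]_x ((f x)%:E * (h x)%:E).
  under eq_integral do rewrite fimfunE -fsumEFin//.
  under [X in X + _]eq_integral do rewrite fimfunE -fsumEFin//.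
  under [X in _ + X]eq_integral.
    move=> x _; rewrite fimfunE -fsumEFin// ge0_mule_fsumr; last by move=> ?; exact: i0.
    over.
  rewrite /= !ge0_integral_fsum//; last 2 first.
  - by move=> r; exact: (emeasurable_funM mf (mi r h)).
  - by move=> r x _; rewrite mule_ge0.
  rewrite -fsbig_split//=; apply: eq_fsbigr => r _.
  (* A scalar leaves the integral only if it is nonnegative; for a negative [r] the level set is
     empty, since [h] is nonnegative. *)
  have [r0|r0] := ltP r 0%R.
    have -> : h @^-1` [set r] = set0.
      by apply/seteqP; split => // x /= hr; have : (0 <= h x)%R by []; rewrite hr leNgt r0.
    under eq_integral do rewrite indic0 mulr0.
    under [X in X + _]eq_integral do rewrite indic0 mulr0.
    under [X in _ + X]eq_integral do rewrite indic0 mulr0 mule0.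
    by rewrite !integral0 adde0.
  under eq_integral do rewrite EFinM.
  under [X in X + _]eq_integral do rewrite EFinM.
  under [X in _ + X]eq_integral do rewrite EFinM muleCA.
  have mI : measurable_fun setT (fun x : R => (\1_(h @^-1` [set r]) x : R)%:E).
    exact/measurable_EFinP.
  rewrite !ge0_integralZl//; last 2 first.
  - exact: (emeasurable_funM mf mI).
  - by move=> x _; rewrite mule_ge0.
  rewrite indicE// ge0_muleDr//; first exact: integral_ge0.
  by apply: integral_ge0 => x _; rewrite mule_ge0.
pose h := nnsfun_approx measurableT mg.
have hg x : EFin \o h^~ x @ \oo --> g x by exact: cvg_nnsfun_approx.
have mh n : measurable_fun setT (fun x => (h n x)%:E) by exact/measurable_EFinP.
have ndh x : {homo (fun n => (h n x)%:E) : n m / (n <= m)%N >-> n <= m}.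
  by move=> n m nm; rewrite lee_fin; exact/lefP/nd_nnsfun_approx.
have gE x : g x = limn (fun n => (h n x)%:E) by apply/esym/cvg_lim => //; exact: hg.
have gfE x : (f x)%:E * g x = limn (fun n => (f x)%:E * (h n x)%:E).
  by rewrite gE limeMl//; apply/cvg_ex; exists (g x); exact: hg.
have cv (m : {measure set R -> \bar R}) :
    \int[m]_x (h n x)%:E @[n --> \oo] --> \int[m]_x g x.
  under eq_integral do rewrite gE.
  apply: cvg_monotone_convergence => //.
  by move=> n x _; rewrite lee_fin.
have cf : \int[leb]_x ((f x)%:E * (h n x)%:E) @[n --> \oo] --> \int[leb]_x ((f x)%:E * g x).
  under eq_integral do rewrite gfE.
  apply: cvg_monotone_convergence => //.
  - by move=> n; exact: (emeasurable_funM mf (mh n)).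
  - by move=> n x _; rewrite mule_ge0// lee_fin.
  - by move=> x _ n m nm; rewrite lee_wpmul2l//; exact: ndh.
apply: (cvg_unique _ (cv p)) => //=.
under eq_fun do rewrite nnsfunE.
apply: cvgeD => //; rewrite ge0_adde_def// inE.
- exact: integral_ge0.
- by apply: integral_ge0 => x _; rewrite mule_ge0.
Qed.

End density.

(** * Splitting the renewal measure *)

Section decomposition.
Context {R : realType}.
Notation leb := (@lebesgue_measure R).
Local Open Scope ereal_scope.

(** The reflection makes [mconv m (reflected A) 0] equal to [m A], so that iterating [mconv] and
    evaluating at [0] gives the convolution powers on [A]. *)
Definition reflected (A : set R) (x : R) : \bar R := (\1_A (- x)%R)%:E.

Lemma reflected_ge0 A x : 0 <= reflected A x.
Proof. by rewrite lee_fin. Qed.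

Lemma measurable_reflected A : measurable A -> measurable_fun setT (reflected A).
Proof.
move=> mA; apply/measurable_EFinP.
have m1 : measurable_fun setT (\1_A : R -> R) by exact: measurable_indic.
exact: (measurableT_comp m1 (@oppr_measurable R setT)).
Qed.

Lemma reflected_bigcup (F : (set R)^nat) x : trivIset setT F ->
  reflected (\bigcup_n F n) x = \sum_(n <oo) reflected (F n) x.
Proof. by move=> tF; rewrite /reflected -indic_bigcup. Qed.

(** The recursion of [convpow] translates the set at each step, so the induction has to run over all
    translates of [A]; only [x = 0] is used in the end. *)
Lemma convpowE (p : probability R R) n A x :
  convpow p n [set y | A (y - x)%R] = iter n (mconv p) (reflected A) x.
Proof.
elim: n x => [|n IHn] x /=.
  rewrite diracE /reflected indicE; congr ((nat_of_bool _)%:R%R)%:E.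
  by apply/idP/idP; rewrite !inE /= sub0r.
rewrite /mconv; apply: eq_integral => z _; rewrite -IHn; congr convpow.
by apply/funext => y /=; congr (A _); ring.
Qed.

Section iterates.
Variable nu : {finite_measure set R -> \bar R}.

Lemma iter_mconv_ge0 n g : (forall x, 0 <= g x) ->
  forall x, 0 <= iter n (mconv nu) g x.
Proof. by move=> g0; elim: n => //= n IHn x; exact: mconv_ge0. Qed.

Lemma measurable_iter_mconv n g : measurable_fun setT g -> (forall x, 0 <= g x) ->
  measurable_fun setT (iter n (mconv nu) g).
Proof.
move=> mg g0; elim: n => //= n IHn; apply: measurable_mconv => //.
exact: iter_mconv_ge0.
Qed.

Lemma iter_mconv_nneseries n (g : nat -> R -> \bar R) :
  (forall k, measurable_fun setT (g k)) -> (forall k x, 0 <= g k x) ->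
  iter n (mconv nu) (fun x => \sum_(k <oo) g k x) =
  (fun x => \sum_(k <oo) iter n (mconv nu) (g k) x).
Proof.
move=> mg g0; elim: n => //= n IHn; rewrite IHn; apply/funext => x.
apply: mconv_nneseries => k; first exact: measurable_iter_mconv.
exact: iter_mconv_ge0.
Qed.

(** Moves the powers of [nu] from the test function to the density, which is how the mixed terms in
    the expansion of [p] become densities. *)
Lemma iter_mconv_fconv n h g :
  measurable_fun setT h -> (forall x, 0 <= h x) ->
  measurable_fun setT g -> (forall x, 0 <= g x) ->
  fconv h (iter n (mconv nu) g) = fconv (iter n (mconv nu) h) g.
Proof.
move=> mh h0 mg g0; elim: n => //= n IHn; apply/funext => x.
rewrite -mconv_fconvr//; last 2 first.
- exact: measurable_iter_mconv.
- exact: iter_mconv_ge0.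
rewrite IHn mconv_fconvl//; first exact: measurable_iter_mconv.
exact: iter_mconv_ge0.
Qed.

(** The sum of all convolution powers of [nu]. Since each power acts on functions, countable
    additivity reduces to an interchange of two nonnegative series. *)
Definition geom_measure (A : set R) : \bar R :=
  \sum_(n <oo) iter n (mconv nu) (reflected A) 0%R.

Let geom0 : geom_measure set0 = 0.
Proof.
rewrite /geom_measure eseries0// => n _ _.
have -> : reflected set0 = (fun=> 0) by apply/funext => x; rewrite /reflected indic0.
suff H x : iter n (mconv nu) (fun=> 0) x = 0 by exact: H.
by elim: n x => //= n IHn x; rewrite /mconv integral0_eq.
Qed.

Let geom_ge0 A : 0 <= geom_measure A.
Proof. by apply: nneseries_ge0 => n _ _; exact/iter_mconv_ge0/reflected_ge0. Qed.

Let geom_sigma_additive : semi_sigma_additive geom_measure.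
Proof.
move=> F mF tF mUF; rewrite [X in _ --> X](_ : _ = \sum_(k <oo) geom_measure (F k)).
  by apply: is_cvg_ereal_nneg_natsum => k _.
rewrite /geom_measure nneseries_interchange; last first.
  by move=> *; exact/iter_mconv_ge0/reflected_ge0.
apply: eq_eseriesr => n _.
rewrite (_ : reflected _ = fun x => \sum_(k <oo) reflected (F k) x).
  rewrite iter_mconv_nneseries// => k; last exact: reflected_ge0.
  exact: measurable_reflected.
by apply/funext => x; rewrite reflected_bigcup.
Qed.

HB.instance Definition _ := isMeasure.Build _ _ _ geom_measure
  geom0 geom_ge0 geom_sigma_additive.

End iterates.

Section renewal_density.
Variables (p : probability R R) (nu : {finite_measure set R -> \bar R}) (f : R -> R).
Hypothesis mf : measurable_fun setT f.
Hypothesis f0 : forall x, (0 <= f x)%R.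
Hypothesis pE : forall A, measurable A -> p A = nu A + \int[leb]_(x in A) (f x)%:E.

Let mfE : measurable_fun setT (EFin \o f). Proof. exact/measurable_EFinP. Qed.
Let fE0 x : 0 <= (EFin \o f) x. Proof. by rewrite lee_fin. Qed.

Lemma mconv_decomp g x : measurable_fun setT g -> (forall x, 0 <= g x) ->
  mconv p g x = mconv nu g x + fconv (EFin \o f) g x.
Proof.
move=> mg g0; apply: ge0_integral_density => //; exact: measurable_shifted.
Qed.

(** The density of the [n]-th power of [p] minus the [n]-th power of [nu]. Multiplying [nu^n + a_n]
    by [p = nu + f dx] leaves [nu^(n+1)] and the density [p * a_n + nu^n * f]; both zeroth powers
    are the point mass at [0], hence the start at zero. *)
Fixpoint ac_part n : R -> \bar R :=
  if n is n'.+1 then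
    fun x => mconv p (ac_part n') x + iter n' (mconv nu) (EFin \o f) x
  else fun=> 0.

Lemma ac_part_ge0 n x : 0 <= ac_part n x.
Proof.
elim: n x => //= n IHn x; apply: adde_ge0; first exact: mconv_ge0.
exact: iter_mconv_ge0.
Qed.

Lemma measurable_ac_part n : measurable_fun setT (ac_part n).
Proof.
elim: n => [|n IHn] /=; first exact: measurable_cst.
apply: emeasurable_funD; last exact: measurable_iter_mconv.
by apply: measurable_mconv => //; exact: ac_part_ge0.
Qed.

Lemma iter_mconv_decomp n g : measurable_fun setT g -> (forall x, 0 <= g x) ->
  iter n (mconv p) g = fun x => iter n (mconv nu) g x + fconv (ac_part n) g x.
Proof.
move=> mg g0; elim: n => [|n IHn]; apply/funext => x /=.
  by rewrite /fconv integral0_eq ?adde0// => z _; rewrite mul0e.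
have mn := measurable_iter_mconv nu n g mg g0.
have n0 := iter_mconv_ge0 nu n g g0.
have ma := measurable_ac_part n; have a0 := ac_part_ge0 n.
rewrite IHn mconvD//; last 2 first.
- exact: measurable_fconv.
- by move=> y; exact: fconv_ge0.
rewrite mconv_decomp// mconv_fconvl// -addeA; congr (_ + _).
rewrite iter_mconv_fconv//.
rewrite (fconvDl (mconv p (ac_part n)) (iter n (mconv nu) (EFin \o f)))//; first by rewrite addeC.
- exact: measurable_mconv.
- exact: measurable_iter_mconv.
- by move=> y; exact: mconv_ge0.
- exact: iter_mconv_ge0.
Qed.

Definition renewal_density x : \bar R := \sum_(n <oo) ac_part n x.
Definition forcing x : \bar R := \sum_(n <oo) iter n (mconv nu) (EFin \o f) x.

Lemma renewal_density_ge0 x : 0 <= renewal_density x.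
Proof. by apply: nneseries_ge0 => n _ _; exact: ac_part_ge0. Qed.

Lemma forcing_ge0 x : 0 <= forcing x.
Proof. by apply: nneseries_ge0 => n _ _; exact: iter_mconv_ge0. Qed.

Lemma measurable_renewal_density : measurable_fun setT renewal_density.
Proof.
apply: ge0_emeasurable_sum => [n x _ _|n _]; first exact: ac_part_ge0.
exact: measurable_ac_part.
Qed.

Lemma measurable_forcing : measurable_fun setT forcing.
Proof.
apply: ge0_emeasurable_sum => [n x _ _|n _]; first exact: iter_mconv_ge0.
exact: measurable_iter_mconv.
Qed.

Lemma renewal_densityE x :
  renewal_density x = mconv p renewal_density x + forcing x.
Proof.
rewrite {1}/renewal_density nneseries_recl//; last by move=> ? _; exact: ac_part_ge0.
rewrite [ac_part 0 x]/= add0e -(nneseries_addn 1)//; last by move=> n; exact: ac_part_ge0.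
rewrite mconv_nneseries; [|exact: measurable_ac_part|exact: ac_part_ge0].
rewrite -nneseriesD; [|by move=> *; exact/mconv_ge0/ac_part_ge0|by move=> *; exact: iter_mconv_ge0].
by apply: eq_eseriesr => n _; rewrite addn1.
Qed.

Lemma forcingE x : forcing x = (f x)%:E + mconv nu forcing x.
Proof.
rewrite {1}/forcing nneseries_recl//; last by move=> ? _; exact: iter_mconv_ge0.
rewrite -(nneseries_addn 1)//; last by move=> n; exact: iter_mconv_ge0.
rewrite mconv_nneseries; [|by move=> n; exact: measurable_iter_mconv|by move=> n; exact: iter_mconv_ge0].
by congr (_ + _); apply: eq_eseriesr => n _; rewrite addn1.
Qed.

Lemma renewalE A : measurable A ->
  renewal p A = \int[leb]_(x in A) renewal_density x + geom_measure nu A.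
Proof.
move=> mA.
have mr := measurable_reflected A mA; have r0 := reflected_ge0 A.
transitivity (\sum_(n <oo) (iter n (mconv nu) (reflected A) 0%R +
    fconv (ac_part n) (reflected A) 0%R)).
  apply: eq_eseriesr => n _.
  rewrite -[RHS](congr1 (@^~ 0%R) (iter_mconv_decomp n (reflected A) mr r0)) -convpowE.
  by congr convpow; apply/funext => y /=; rewrite subr0.
rewrite nneseriesD//; last 2 first.
- by move=> n _ _; exact: iter_mconv_ge0.
- by move=> n _ _; apply: fconv_ge0 => //; exact: ac_part_ge0.
rewrite addeC; congr (_ + _).
rewrite -fconv_nneseriesl//; last 2 first.
- exact: measurable_ac_part.
- exact: ac_part_ge0.
rewrite [RHS]integral_mkcond/=; apply: eq_integral => x _.
rewrite patchE /reflected sub0r opprK indicE.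
by case: ifPn; rewrite ?mule1 ?mule0.
Qed.

End renewal_density.
End decomposition.

(** * Exponential moments and bounds *)

Section exp_inequalities.
Context {R : realType}.
Implicit Types (u x s tau : R).

Lemma expR_sub1_le u : expR u - 1 <= u * expR u.
Proof.
have := expR_ge1Dx (- u); rewrite expRN => h.
have e0 := expR_gt0 u.
have : (1 - u) * expR u <= 1 by rewrite -ler_pdivlMr// div1r.
by rewrite mulrBl mul1r; lra.
Qed.

Lemma expR_taylor1 u : `|expR u - 1 - u| <= u ^+ 2 * expR `|u|.
Proof.
have h1 := expR_ge1Dx u; have h2 := expR_sub1_le u.
rewrite ger0_norm; last lra.
have [u0|u0] := leP 0 u.
  rewrite ger0_norm//; have : u * (expR u - 1) <= u * (u * expR u) by rewrite ler_wpM2l.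
  by rewrite expr2 -mulrA; lra.
have e1 : 1 <= expR `|u| by rewrite -expR0 ler_expR.
have : - u * (1 - expR u) <= - u * (- u) by rewrite ler_wpM2l; lra.
have : u ^+ 2 * 1 <= u ^+ 2 * expR `|u| by rewrite ler_wpM2l// sqr_ge0.
by rewrite expr2; lra.
Qed.

Lemma le_expR u : u <= expR u.
Proof. by have := expR_ge1Dx u; lra. Qed.

(** With [v = tau |x| / 2], one factor [exp v] absorbs [exp (s |x|)] and another absorbs [|x|]. The
    excess over [1] is linear in [s], so a small [s] perturbs the mass of a measure as little as
    desired. *)
Lemma expR_abs_le tau s x : 0 < tau -> 0 <= s -> s <= tau / 2 ->
  expR (s * `|x|) <= 1 + s * (2 / tau) * expR (tau * `|x|).
Proof.
move=> t0 s0 st; have := expR_sub1_le (s * `|x|).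
set v := tau / 2 * `|x|.
have x0 : 0 <= `|x| by [].
have h1 : expR (s * `|x|) <= expR v by rewrite ler_expR ler_wpM2r.
have h2 : v <= expR v := le_expR v.
have -> : tau * `|x| = v + v by rewrite /v; lra.
rewrite expRD.
have v0 : 0 <= v by rewrite /v mulr_ge0//; lra.
have : s * `|x| * expR (s * `|x|) <= s * (2 / tau) * (expR v * expR v).
  have -> : s * `|x| * expR (s * `|x|) = s * (2 / tau) * (v * expR (s * `|x|)).
    by rewrite /v; field; lra.
  apply: ler_wpM2l; first by rewrite mulr_ge0// divr_ge0//; lra.
  by apply: ler_pM => //; exact: expR_ge0.
lra.
Qed.

(** Half of [exp (tau |x|)] absorbs [exp |s x|]; the other half absorbs [x ^+ 2] through
    [t ^+ 2 <= exp (2 t)] at [t = tau |x| / 4], hence the [16]. *)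
Lemma expR_taylor1_abs tau s x : 0 < tau -> `|s| <= tau / 2 ->
  `|expR (s * x) - 1 - s * x| <= s ^+ 2 * (16 / tau ^+ 2) * expR (tau * `|x|).
Proof.
move=> t0 st; apply: (le_trans (expR_taylor1 _)).
set v := tau / 2 * `|x|.
have -> : tau * `|x| = v + v by rewrite /v; lra.
have v0 : 0 <= v by rewrite /v mulr_ge0//; lra.
suff : x ^+ 2 * expR `|s * x| <= (16 / tau ^+ 2 * expR v) * expR v.
  move=> /(ler_wpM2l (sqr_ge0 s)) h; rewrite expRD exprMn.
  by rewrite -[leLHS]mulrA (le_trans h)// -[leRHS]mulrA !mulrA.
apply: ler_pM; [exact: sqr_ge0|exact: expR_ge0| |].
- have h : (v / 2) ^+ 2 <= expR v.
    have -> : expR v = expR (v / 2) ^+ 2 by rewrite -expRM_natl; congr expR; lra.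
    by rewrite lerXn2r// ?nnegrE ?expR_ge0 ?divr_ge0// le_expR.
  rewrite -[leLHS]real_normK ?num_real//.
  have -> : `|x| ^+ 2 = 16 / tau ^+ 2 * (v / 2) ^+ 2 by rewrite /v; field; lra.
  by rewrite ler_wpM2l// divr_ge0// sqr_ge0.
- by rewrite ler_expR normrM ler_wpM2r.
Qed.

End exp_inequalities.

Section exponential_moments.
Context {R : realType}.
Local Open Scope ereal_scope.

Lemma measurable_expRM (s : R) : measurable_fun setT (fun x : R => expR (s * x)).
Proof. by apply: measurableT_comp => //; exact: mulrl_measurable. Qed.

Lemma measurable_expRMabs (s : R) : measurable_fun setT (fun x : R => expR (s * `|x|)).
Proof.
by apply: measurableT_comp => //; apply: measurable_funM.
Qed.

(** The mass [g] is left free because the bound serves three measures: [p], its defective part [nu],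
    and what remains of [p] when the uniform part of the coupled jump is removed. *)
Lemma exp_moment_abs_le (m : {measure set R -> \bar R}) (tau M g s : R) :
  (0 < tau)%R -> \int[m]_x (expR (tau * `|x|))%:E <= M%:E -> m setT <= g%:E ->
  (0 <= s)%R -> (s <= tau / 2)%R ->
  \int[m]_x (expR (s * `|x|))%:E <= (g + s * (2 / tau) * M)%:E.
Proof.
move=> t0 mM mg s0 st.
have k0 : (0 <= s * (2 / tau))%R by rewrite mulr_ge0// divr_ge0// ltW.
have mE r : measurable_fun setT (fun x : R => (expR (r * `|x|))%:E).
  by apply/measurable_EFinP; exact: measurable_expRMabs.
apply: (@le_trans _ _ (\int[m]_x (1 + (s * (2 / tau))%:E * (expR (tau * `|x|))%:E))).
  apply: ge0_le_integral => //.
  - by apply: emeasurable_funD => //; exact: measurable_funeM.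
  - by move=> x _; rewrite -EFinM -EFinD lee_fin expR_abs_le.
rewrite ge0_integralD//; last 2 first.
- by move=> x _; rewrite mule_ge0 ?lee_fin// expR_ge0.
- exact: measurable_funeM.
rewrite integral_cst// mul1e ge0_integralZl//.
by rewrite EFinD (EFinM _ M); apply: leeD => //; apply: lee_wpmul2l.
Qed.

Lemma exp_moment_le (m : {measure set R -> \bar R}) (s r : R) :
  (`|r| <= s)%R ->
  \int[m]_x (expR (r * x))%:E <= \int[m]_x (expR (s * `|x|))%:E.
Proof.
move=> rs; apply: ge0_le_integral => //.
- by apply/measurable_EFinP; exact: measurable_expRM.
- by apply/measurable_EFinP; exact: measurable_expRMabs.
- move=> x _; rewrite lee_fin ler_expR (le_trans (ler_norm _))// normrM.
  by rewrite ler_wpM2r.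
Qed.

(** Exponentials are eigenfunctions of convolution with [m], and the eigenvalue is a Laplace
    transform. All exponential bounds on iterates rest on this. *)
Lemma mconv_expR (m : {measure set R -> \bar R}) (k s y : R) : (0 <= k)%R ->
  mconv m (fun x => (k * expR (s * x))%:E) y =
  (k * expR (s * y))%:E * \int[m]_x (expR ((- s) * x))%:E.
Proof.
move=> k0; rewrite /mconv -ge0_integralZl//; last 2 first.
- by apply/measurable_EFinP; exact: measurable_expRM.
- by rewrite lee_fin mulr_ge0// expR_ge0.
apply: eq_integral => x _; rewrite -EFinM; congr EFin.
by rewrite -mulrA -expRD; congr (_ * expR _)%R; ring.
Qed.

Lemma iter_mconv_expR_le (m : {finite_measure set R -> \bar R}) (g k s : R)
    (h : R -> \bar R) n y :
  (0 <= k)%R -> (0 <= g)%R ->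
  measurable_fun setT h -> (forall x, 0 <= h x) ->
  (forall x, h x <= (k * expR (s * x))%:E) ->
  \int[m]_x (expR ((- s) * x))%:E <= g%:E ->
  iter n (mconv m) h y <= (k * expR (s * y) * g ^+ n)%:E.
Proof.
move=> k0 g0 mh h0 hk mg; elim: n y => [|n IHn] y /=; first by rewrite expr0 mulr1.
have kg0 : (0 <= k * g ^+ n)%R by rewrite mulr_ge0// exprn_ge0.
apply: (@le_trans _ _ (mconv m (fun x => ((k * g ^+ n) * expR (s * x))%:E) y)).
  apply: le_mconv.
  - exact: measurable_iter_mconv.
  - by apply/measurable_EFinP; apply: measurable_funM => //; exact: measurable_expRM.
  - exact: iter_mconv_ge0.
  - by move=> x; rewrite (le_trans (IHn x))// lee_fin mulrAC.
rewrite mconv_expR//.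
have -> : (k * expR (s * y) * g ^+ n.+1 = (k * g ^+ n * expR (s * y)) * g)%R.
  by rewrite exprSr; ring.
by rewrite [leRHS]EFinM lee_wpmul2l// lee_fin mulr_ge0// expR_ge0.
Qed.

Lemma nneseries_geometric_le (u : nat -> \bar R) (c g : R) :
  (0 <= c)%R -> (0 <= g < 1)%R -> (forall n, 0 <= u n) ->
  (forall n, u n <= (c * g ^+ n)%:E) ->
  \sum_(n <oo) u n <= (c / (1 - g))%:E.
Proof.
move=> c0 /andP[g0 g1] u0 uc; apply: lime_le; first exact: is_cvg_nneseries.
apply: nearW => n; apply: (@le_trans _ _ (\sum_(0 <= k < n) (c * g ^+ k)%:E)).
  exact: lee_sum.
rewrite sumEFin lee_fin -mulr_sumr ler_wpM2l//.
elim: n => [|n IHn]; first by rewrite big_geq// invr_ge0; lra.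
rewrite big_nat_recl//= expr0 (_ : (1 - g)^-1 = 1 + g * (1 - g)^-1)%R; last first.
  by field; lra.
rewrite lerD2l; under eq_bigr do rewrite exprS.
by rewrite -mulr_sumr ler_wpM2l.
Qed.

End exponential_moments.

Section laplace.
Context {R : realType}.
Variables (p : probability R R) (tau M : R).
Hypothesis tau0 : 0 < tau.
Hypothesis pM : (\int[p]_x (expR (tau * `|x|))%:E <= M%:E)%E.

Lemma integrable_expRMabs : p.-integrable setT (fun x : R => (expR (tau * `|x|))%:E).
Proof.
apply/integrableP; split; first by apply/measurable_EFinP; exact: measurable_expRMabs.
under eq_integral do rewrite gee0_abs ?lee_fin ?expR_ge0//.
by rewrite (le_lt_trans pM)// ltry.
Qed.

Lemma integrable_expRM (e : R) : `|e| <= tau ->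
  p.-integrable setT (fun x : R => (expR (e * x))%:E).
Proof.
move=> et; apply: le_integrable integrable_expRMabs => //.
  by apply/measurable_EFinP; exact: measurable_expRM.
move=> x _; rewrite !gee0_abs ?lee_fin ?expR_ge0// ler_expR.
by rewrite (le_trans (ler_norm _))// normrM ler_wpM2r.
Qed.

Lemma integrable_id : p.-integrable setT (fun x : R => x%:E).
Proof.
apply: le_integrable (integrableZl measurableT tau^-1 integrable_expRMabs) => //.
  exact/measurable_EFinP.
move=> x _; rewrite -EFinM !abse_EFin lee_fin.
by apply: le_trans (ler_norm _); rewrite ler_pdivlMl// le_expR.
Qed.

(** The pointwise expansion is integrated. The error is of second order with a constant made of
    [tau] and [M] only, which makes the effect of the drift uniform over the family. *)
Lemma laplace_taylor (e : R) : `|e| <= tau / 2 ->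
  exists2 m : R, (\int[p]_x (expR (e * x))%:E = m%:E)%E &
    `|m - 1 - e * pmean p| <= e ^+ 2 * (16 / tau ^+ 2) * M.
Proof.
move=> et; have et' : `|e| <= tau by have := tau0; lra.
have ie := integrable_expRM e et'; have ix := integrable_id.
have i1 : p.-integrable setT (fun=> 1%:E : \bar R) by exact: finite_measure_integrable_cst.
exists (fine (\int[p]_x (expR (e * x))%:E)%E).
  by rewrite fineK//; exact: integrable_fin_num.
have -> : fine (\int[p]_x (expR (e * x))%:E)%E - 1 - e * pmean p =
    \int[p]_x (expR (e * x) - 1 - e * x).
  rewrite RintegralB//; last 2 first.
  - exact: (integrableB measurableT ie i1).
  - exact: (integrableZl measurableT e ix).
  rewrite RintegralB// RintegralZl// Rintegral_cst// mul1r /= probability_setT/=.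
  by [].
have iB : p.-integrable setT (EFin \o (fun x => expR (e * x) - 1 - e * x)).
  exact: (integrableB measurableT (integrableB measurableT ie i1) (integrableZl measurableT e ix)).
apply: (le_trans (le_normr_Rintegral _ iB)) => //.
have iM : p.-integrable setT
    (EFin \o (fun x => e ^+ 2 * (16 / tau ^+ 2) * expR (tau * `|x|))).
  exact: (integrableZl measurableT _ integrable_expRMabs).
apply: (@le_trans _ _ (\int[p]_x (e ^+ 2 * (16 / tau ^+ 2) * expR (tau * `|x|)))).
  apply: le_Rintegral => //; first exact: integrable_norm.
  by move=> x _; exact: expR_taylor1_abs.
rewrite RintegralZl//; last exact: integrable_expRMabs.
apply: ler_wpM2l; first by rewrite mulr_ge0 ?sqr_ge0// divr_ge0// sqr_ge0.
rewrite /Rintegral -lee_fin fineK//; exact/integrable_fin_num/integrable_expRMabs.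
Qed.

End laplace.

Section renewal_bounds.
Context {R : realType}.
Notation leb := (@lebesgue_measure R).
Local Open Scope ereal_scope.

Variables (p : probability R R) (nu : {finite_measure set R -> \bar R}) (f : R -> R).
Hypothesis mf : measurable_fun setT f.
Hypothesis f0 : forall x, (0 <= f x)%R.
Hypothesis pE : forall A, measurable A -> p A = nu A + \int[leb]_(x in A) (f x)%:E.
Variables (s g m C : R).
Hypothesis g01 : (0 <= g < 1)%R.
Hypothesis C0 : (0 <= C)%R.
Hypothesis nug : forall r : R, (`|r| <= s)%R -> \int[nu]_x (expR (r * x))%:E <= g%:E.
Hypothesis fC : forall r x : R, (`|r| <= s)%R -> (f x <= C * expR (r * x))%R.

Lemma le_integral_sub (h : R -> \bar R) : measurable_fun setT h -> (forall x, 0 <= h x) ->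
  \int[nu]_x h x <= \int[p]_x h x.
Proof.
move=> mh h0; rewrite (ge0_integral_density p nu f h)//.
by rewrite leeDl// integral_ge0// => x _; rewrite mule_ge0// lee_fin.
Qed.

Lemma forcing_le (r x : R) : (`|r| <= s)%R ->
  forcing nu f x <= (C / (1 - g) * expR (r * x))%:E.
Proof.
move=> rs; rewrite mulrAC; apply: nneseries_geometric_le => //.
- by rewrite mulr_ge0// expR_ge0.
- by move=> n; apply: iter_mconv_ge0 => y; rewrite lee_fin.
- move=> n; have /andP[g0 _] := g01.
  apply: iter_mconv_expR_le => //.
  + exact/measurable_EFinP.
  + by move=> y; rewrite lee_fin fC.
  + by apply: nug; rewrite normrN.
Qed.

(** A Chernoff bound: the indicator of [A] is majorized by an exponential, on which [nu] acts with a
    factor at most [g]. Opposite signs of [r] give the two tails, and [r = 0] the total mass. *)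
Lemma geom_measure_le (A : set R) (k r : R) : measurable A -> (0 <= k)%R ->
  (`|r| <= s)%R -> (forall x, A x -> (1 <= k * expR (r * x)))%R ->
  geom_measure nu A <= (k / (1 - g))%:E.
Proof.
move=> mA k0 rs Ak; apply: nneseries_geometric_le => //.
  by move=> n; exact/iter_mconv_ge0/reflected_ge0.
move=> n; have /andP[g0 _] := g01.
have := @iter_mconv_expR_le _ nu g k (- r) (reflected A) n 0%R k0 g0
  (measurable_reflected A mA) (reflected_ge0 A).
rewrite mulr0 expR0 mulr1 opprK; apply; last exact: nug.
move=> x; rewrite /reflected lee_fin indicE.
have [xA|_] := boolP (_ \in A); last by rewrite mulr_ge0// expR_ge0.
by rewrite mulNr -mulrN; apply: Ak; rewrite inE in xA.
Qed.

Hypothesis s0 : (0 <= s)%R.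
Hypothesis m01 : (0 <= m < 1)%R.
Hypothesis pm : \int[p]_x (expR ((- s) * x))%:E <= m%:E.

(** The constant is the fixed point of [B = B * m + C / (1 - g)], so the renewal recursion preserves
    the bound. The induction runs on partial sums because finiteness of the series is not yet
    known. *)
Lemma renewal_density_le (x : R) :
  renewal_density p nu f x <= (C / (1 - g) / (1 - m) * expR (s * x))%:E.
Proof.
have /andP[m0 m1] := m01; have /andP[g0 g1] := g01.
set B := (C / (1 - g) / (1 - m))%R.
have B0 : (0 <= B)%R by rewrite /B !divr_ge0//; lra.
have ac0 := ac_part_ge0 p nu f f0; have mac := measurable_ac_part p nu f mf f0.
apply: lime_le; first by apply: is_cvg_nneseries => n _ _; exact: ac0.
apply: nearW => n; elim: n x => [|n IHn] x.
  by rewrite big_geq// lee_fin mulr_ge0// expR_ge0.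
rewrite big_nat_recl//= add0e big_split/=.
apply: (@le_trans _ _ (mconv p (fun y => (B * expR (s * y))%:E) x +
   (C / (1 - g) * expR (s * x))%:E)).
  apply: leeD.
    have -> : \sum_(0 <= i < n) mconv p (ac_part p nu f i) x =
        mconv p (fun y => \sum_(0 <= i < n) ac_part p nu f i y) x.
      rewrite /mconv ge0_integral_sum// => i.
      exact: (measurable_shifted _ x (mac i)).
    apply: le_mconv => //.
    - exact: emeasurable_sum.
    - by apply/measurable_EFinP; apply: measurable_funM => //; exact: measurable_expRM.
    - by move=> y; apply: sume_ge0.
  apply: le_trans (forcing_le s x _); last by rewrite ger0_norm.
  by apply: nneseries_lim_ge => k _ _; apply: iter_mconv_ge0 => y; rewrite lee_fin.
rewrite mconv_expR//.
apply: (@le_trans _ _ ((B * expR (s * x))%:E * m%:E + (C / (1 - g) * expR (s * x))%:E)).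
  by rewrite leeD2r// lee_wpmul2l// lee_fin mulr_ge0// expR_ge0.
rewrite -EFinM -EFinD lee_fin le_eqVlt; apply/orP; left; apply/eqP.
by rewrite /B; field; lra.
Qed.

End renewal_bounds.

(** * Coupling of two solutions of the renewal equation *)

Section density_measure.
Context {R : realType}.
Notation leb := (@lebesgue_measure R).
Local Open Scope ereal_scope.
Variable f : R -> R.
Hypothesis mf : measurable_fun setT f.
Hypothesis f0 : forall x, (0 <= f x)%R.

(* The two proofs are arguments so that the measure structure can be inferred. *)
Definition density_measure of measurable_fun setT f & (forall x, (0 <= f x)%R) :=
  fun A : set R => \int[leb]_(x in A) (f x)%:E.

Let dens := density_measure mf f0.

Let dens0 : dens set0 = 0.
Proof. by rewrite /dens /density_measure integral_set0. Qed.

Let dens_ge0 A : 0 <= dens A.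
Proof. by apply: integral_ge0 => x _; rewrite lee_fin. Qed.

Let dens_sigma_additive : semi_sigma_additive dens.
Proof.
move=> F mF tF mUF; rewrite [X in _ --> X](_ : _ = \sum_(k <oo) dens (F k)).
  by apply: is_cvg_ereal_nneg_natsum => k _.
rewrite /dens /density_measure ge0_integral_bigcup//.
  by apply/measurable_EFinP; exact: measurable_funTS.
by move=> x _; rewrite lee_fin.
Qed.

HB.instance Definition _ := isMeasure.Build _ _ _ dens dens0 dens_ge0 dens_sigma_additive.

End density_measure.

(** * Exchange of two adjacent intervals *)

Section steps.
Context {R : realType}.
Notation leb := (@lebesgue_measure R).
Local Open Scope ereal_scope.

Lemma integral_itv_shift (h : R -> R) (a b t : R) :
  measurable_fun setT h -> (forall x, (0 <= h x)%R) ->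
  \int[leb]_(u in `[a, b[) (h (u + t)%R)%:E =
  \int[leb]_(u in `[(a + t)%R, (b + t)%R[) (h u)%:E.
Proof.
move=> mh h0; rewrite [LHS]integral_mkcond [RHS]integral_mkcond/=.
rewrite -[RHS](ge0_integral_shift _ (- t)%R); last 2 first.
- apply/(measurable_restrictT _ _).1 => //.
  by apply/measurable_EFinP; exact: measurable_funTS.
- by move=> x; rewrite patchE; case: ifP => // _; rewrite lee_fin.
apply: eq_integral => x _; rewrite !patchE opprK.
by congr (if _ then _ else _); apply/idP/idP; rewrite !inE/= !in_itv/= lerD2r ltrD2r.
Qed.

Lemma integral_itv_split (h : R -> R) (a b c : R) : (a <= b)%R -> (b <= c)%R ->
  measurable_fun setT h -> (forall x, (0 <= h x)%R) ->
  \int[leb]_(u in `[a, c[) (h u)%:E =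
  \int[leb]_(u in `[a, b[) (h u)%:E + \int[leb]_(u in `[b, c[) (h u)%:E.
Proof.
move=> ab bc mh h0.
have -> : `[a, c[%classic = `[a, b[ `|` `[b, c[ :> set R.
  apply/seteqP; split => x /=; rewrite !in_itv/=.
    by move=> /andP[ax xc]; have [xb|bx] := ltP x b; [left|right]; rewrite ?ax ?xc ?bx ?xb.
  move=> [] /andP[h1 h2]; apply/andP; split; lra.
rewrite ge0_integral_setU//.
- by apply/measurable_EFinP; exact: measurable_funTS.
- by move=> x _; rewrite lee_fin.
- rewrite disj_set2E; apply/eqP/seteqP; split => // x [] /=; rewrite !in_itv/= => /andP[_ h1] /andP[h2 _]; lra.
Qed.

(** Swapping [[a, b[] and [[b, c[] inside [[a, c[] preserves Lebesgue measure. This is the coupling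
    of the two uniform jumps: they differ by [c - b] on the first block and by [-(b - a)] on the
    second, and the choice of [b] decides what happens to the distance. *)
Lemma integral_interval_exchange (h : R -> R) (a b c : R) : (a <= b)%R -> (b <= c)%R ->
  measurable_fun setT h -> (forall x, (0 <= h x)%R) ->
  \int[leb]_(u in `[a, c[) (h u)%:E =
  \int[leb]_(u in `[a, b[) (h (u + (c - b))%R)%:E +
  \int[leb]_(u in `[b, c[) (h (u - (b - a))%R)%:E.
Proof.
move=> ab bc mh h0; rewrite !integral_itv_shift//.
rewrite (_ : b - (b - a) = a)%R; last by lra.
rewrite (_ : b + (c - b) = c)%R; last by lra.
rewrite (_ : a + (c - b) = c - (b - a))%R; last by lra.
by rewrite addeC -integral_itv_split//; lra.
Qed.

End steps.

Section one_step.
Context {R : realType}.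
Notation leb := (@lebesgue_measure R).
Local Open Scope ereal_scope.

Variables (p : probability R R) (q f : R -> R).
Hypothesis mq : measurable_fun setT q.
Hypothesis q0 : forall x, (0 <= q x)%R.
Hypothesis f0 : forall x, (0 <= f x)%R.
Hypothesis qE : forall y, (q y)%:E = (f y)%:E + \int[p]_z (q (y - z)%R)%:E.

Let mqs y : measurable_fun setT (fun z : R => (q (y - z)%R)%:E).
Proof. by apply/measurable_EFinP; exact: (measurableT_comp mq (measurable_shiftN y)). Qed.

Let qs0 y z : 0 <= (q (y - z)%R)%:E. Proof. by rewrite lee_fin. Qed.

Let intE y : \int[p]_z (q (y - z)%R)%:E = (q y - f y)%:E.
Proof. by rewrite EFinB qE (addeC (f y)%:E) addeK. Qed.

(** Only [y] jumps, while [q y'] is written as its own average under [p]. Two one-sided inequalities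
    between nonnegative integrands replace the integral of a difference. *)
Lemma step_one (U : R -> R) (y y' K : R) :
  measurable_fun setT U -> (forall z, (0 <= U z)%R) ->
  (forall z, (`|q (y - z) - q y'| <= U z)%R) -> \int[p]_z (U z)%:E <= K%:E ->
  (`|q y - q y'| <= f y + K)%R.
Proof.
move=> mU U0 qU UK; have mUE : measurable_fun setT (EFin \o U) by exact/measurable_EFinP.
have cstE : \int[p]_z (q y')%:E = (q y')%:E.
  by rewrite integral_cst//= probability_setT mule1.
have h1 : (q y')%:E <= (q y - f y)%:E + K%:E.
  apply: (@le_trans _ _ (\int[p]_z ((q (y - z)%R)%:E + (U z)%:E))).
    rewrite -cstE; apply: ge0_le_integral => //.
    - by move=> z _; rewrite lee_fin.
    - exact: emeasurable_funD.
    - by move=> z _; rewrite -EFinD lee_fin; have := qU z; rewrite ler_distl => /andP[]; lra.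
  by rewrite ge0_integralD// ?intE ?leeD2l// => z _; rewrite lee_fin.
have h2 : (q y - f y)%:E <= (q y')%:E + K%:E.
  rewrite -intE; apply: (@le_trans _ _ (\int[p]_z ((q y')%:E + (U z)%:E))).
    apply: ge0_le_integral => //.
    - exact: emeasurable_funD.
    - by move=> z _; rewrite -EFinD lee_fin; have := qU z; rewrite ler_distl => /andP[]; lra.
  by rewrite ge0_integralD// ?cstE ?leeD2l// => z _; rewrite lee_fin.
move: h1 h2; rewrite -!EFinD !lee_fin ler_distl => h1 h2; have := f0 y.
by move=> ?; apply/andP; split; lra.
Qed.

Variables (nu : {measure set R -> \bar R}) (phi : R -> R).
Hypothesis mphi : measurable_fun setT phi.
Hypothesis phi0 : forall x, (0 <= phi x)%R.
Hypothesis pE : forall A, measurable A -> p A = nu A + \int[leb]_(x in A) (phi x)%:E.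
Variables (eta a c : R).
Hypothesis eta0 : (0 <= eta)%R.
Hypothesis ac : (a <= c)%R.
Hypothesis phieta : forall x, (a <= x < c)%R -> (eta <= phi x)%R.

Let unif (x : R) : R := (eta * \1_`[a, c[%classic x)%R.

Let munif : measurable_fun setT unif.
Proof. by apply: measurable_funM => //; exact: measurable_indic. Qed.

Let unif0 x : (0 <= unif x)%R. Proof. by rewrite mulr_ge0. Qed.

Let rest (x : R) : R := (phi x - unif x)%R.

Let mrest : measurable_fun setT rest. Proof. exact: measurable_funB. Qed.

Let rest0 x : (0 <= rest x)%R.
Proof.
rewrite subr_ge0 /unif indicE; have [|_] := boolP (x \in _); last by rewrite mulr0.
by rewrite inE /= in_itv /= mulr1 => /phieta.
Qed.

Let residual := measure_add nu (density_measure rest mrest rest0).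

Let pE' A : measurable A -> p A = residual A + \int[leb]_(x in A) (unif x)%:E.
Proof.
move=> mA; rewrite pE// /residual measure_addE -addeA; congr (_ + _).
rewrite /density_measure -ge0_integralD//.
- by apply: eq_integral => x _; rewrite -EFinD /rest subrK.
- by move=> x _; rewrite lee_fin.
- by apply/measurable_EFinP; exact: measurable_funTS.
- by move=> x _; rewrite lee_fin.
- by apply/measurable_EFinP; exact: measurable_funTS.
Qed.

Let integral_residual (h : R -> \bar R) :
  measurable_fun setT h -> (forall x, 0 <= h x) ->
  \int[p]_x h x = \int[residual]_x h x + eta%:E * \int[leb]_(x in `[a, c[) h x.
Proof.
move=> mh h0; rewrite (ge0_integral_density p residual unif h)//; congr (_ + _).
rewrite [in RHS]integral_mkcond -ge0_integralZl//=.
- apply: eq_integral => x _; rewrite /unif patchE indicE.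
  by case: ifPn; rewrite ?mulr1 ?mulr0 ?mul0e ?mule0.
- by apply/(measurable_restrictT _ _).1 => //; exact: measurable_funTS.
- by move=> x _; rewrite patchE; case: ifP.
Qed.

Variables (tau M s : R).
Hypothesis tau0 : (0 < tau)%R.
Hypothesis pM : \int[p]_x (expR (tau * `|x|))%:E <= M%:E.
Hypothesis s0 : (0 <= s)%R.
Hypothesis st : (s <= tau / 2)%R.

Let residual_exp_le :
  \int[residual]_x (expR (s * `|x|))%:E <= (1 - eta * (c - a) + s * (2 / tau) * M)%:E.
Proof.
apply: exp_moment_abs_le => //.
- apply: le_trans pM; rewrite integral_residual//.
  + by rewrite leeDl// mule_ge0 ?lee_fin// integral_ge0.
  + by apply/measurable_EFinP; exact: measurable_expRMabs.
- have := integral_residual (fun=> 1) (measurable_cst _) (fun _ => lee01).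
  rewrite !integral_cst//= !mul1e probability_setT lebesgue_measure_itv/= lte_fin.
  case: ltP => [_|ca].
    by rewrite -EFinB -EFinM => h; rewrite EFinB [X in _ <= X - _]h addeK.
  by rewrite mule0 adde0 => <-; rewrite lee_fin (_ : c = a) ?subrr ?mulr0 ?subr0//; have := ac; lra.
Qed.

(* The uniform part of the jump of the second walk is rearranged by the
   exchange of [a, b[ and [b, c[, the rest of the two jumps being equal. *)
Lemma step_both (y y' b k k1 k2 : R) : (a <= b)%R -> (b <= c)%R -> (0 <= k)%R ->
  (0 <= k1)%R -> (0 <= k2)%R ->
  (forall z, (q (y - z) <= q (y' - z) + k * expR (s * `|z|)))%R ->
  (forall u, (a <= u <= b -> q (y - u) <= q (y' - (u + (c - b))) + k1))%R ->
  (forall u, (b <= u <= c -> q (y - u) <= q (y' - (u - (b - a))) + k2))%R ->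
  (q y <= q y' + f y + k * (1 - eta * (c - a) + s * (2 / tau) * M)
   + eta * (k1 * (b - a) + k2 * (c - b)))%R.
Proof.
move=> ab bc k0 k10 k20 qk qk1 qk2.
have mqr (x : R) : measurable_fun setT (fun z : R => q (x - z)%R).
  exact: (measurableT_comp mq (measurable_shiftN x)).
have h1 : \int[residual]_z (q (y - z)%R)%:E <= \int[residual]_z (q (y' - z)%R)%:E +
    (k * (1 - eta * (c - a) + s * (2 / tau) * M))%:E.
  have mk : measurable_fun setT (fun z : R => (expR (s * `|z|))%:E).
    by apply/measurable_EFinP; exact: measurable_expRMabs.
  apply: (@le_trans _ _ (\int[residual]_z
      ((q (y' - z)%R)%:E + k%:E * (expR (s * `|z|))%:E))).
    apply: ge0_le_integral => //.
    - by apply: emeasurable_funD => //; exact: measurable_funeM.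
    - by move=> z _; rewrite -EFinM -EFinD lee_fin.
  rewrite ge0_integralD//; last 2 first.
  - by move=> z _; rewrite mule_ge0.
  - exact: measurable_funeM.
  by rewrite ge0_integralZl// EFinM; apply: leeD => //; apply: lee_wpmul2l.
have h2 : \int[leb]_(u in `[a, c[) (q (y - u)%R)%:E <=
    \int[leb]_(u in `[a, c[) (q (y' - u)%R)%:E + (k1 * (b - a) + k2 * (c - b))%:E.
  have part (i j k' t : R) : (i <= j)%R -> (0 <= k')%R ->
      (forall u, (i <= u <= j -> q (y - u) <= q (y' - (u + t)) + k'))%R ->
      \int[leb]_(u in `[i, j[) (q (y - u)%R)%:E <=
      \int[leb]_(u in `[i, j[) (q (y' - (u + t))%R)%:E + (k' * (j - i))%:E.
    move=> ij k'0 qk'.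
    have -> : (k' * (j - i))%:E = \int[leb]_(u in `[i, j[) k'%:E.
      rewrite integral_cst//= lebesgue_measure_itv/= lte_fin EFinM.
      by case: ltP => // ji; congr (_ * _%:E); lra.
    have mt : measurable_fun `[i, j[%classic (fun u => (q (y' - (u + t))%R)%:E).
      apply/measurable_EFinP/measurable_funTS; rewrite (_ : (fun _ => _) = fun u => q ((y' - t) - u)%R)//.
      by apply/funext => u; congr q; lra.
    rewrite -ge0_integralD//.
    apply: ge0_le_integral => //.
    - exact: (measurable_funTS (mqs y)).
    - by apply: emeasurable_funD.
    - by move=> u /=; rewrite in_itv/= => /andP[h3 /ltW h4]; rewrite -EFinD lee_fin qk'// h3.
  rewrite (integral_itv_split (fun u => q (y - u)%R) a b c)//.
  rewrite (integral_interval_exchange (fun u => q (y' - u)%R) a b c)//.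
  have add4 (i1 i2 j1 j2 : \bar R) (r1 r2 : R) : i1 <= j1 + r1%:E -> i2 <= j2 + r2%:E ->
      i1 + i2 <= j1 + j2 + (r1 + r2)%:E.
    by move=> h3 h4; rewrite EFinD addeACA; exact: leeD.
  apply: add4; first exact: (part a b k1 (c - b)%R ab k10 qk1).
  exact: (part b c k2 (- (b - a))%R bc k20 qk2).
have hfin : \int[residual]_z (q (y' - z)%R)%:E +
    eta%:E * \int[leb]_(u in `[a, c[) (q (y' - u)%R)%:E = (q y' - f y')%:E.
  by rewrite -integral_residual ?intE.
have : (q y - f y)%:E <= (q y' - f y')%:E + (k * (1 - eta * (c - a) + s * (2 / tau) * M))%:E
   + (eta * (k1 * (b - a) + k2 * (c - b)))%:E.
  rewrite -intE integral_residual// -hfin [X in _ <= X + _]addeAC -addeA.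
  apply: leeD => //; rewrite EFinM -ge0_muleDr//.
  - by rewrite lee_wpmul2l// lee_fin.
  - by apply: integral_ge0 => u _; rewrite lee_fin.
  - by rewrite lee_fin addr_ge0// mulr_ge0//; lra.
by rewrite -!EFinD lee_fin; have := f0 y'; lra.
Qed.

End one_step.

Section weight.
Context {R : realType}.
Variables (beta dl D : R).
Hypothesis beta0 : 0 < beta.
Hypothesis dl0 : 0 < dl.
Hypothesis dlD : dl <= D.

(** The concave part [t * (2 * F - t)] is frozen beyond [D], before its vertex [F], so [w] is
    nondecreasing. Its second difference with step [dl] is [-2 * dl ^+ 2], and [a] is scaled so that
    [a * dl ^+ 2 = 2 * G], twice the bound [G] on the exponential part up to [F]. The term
    [3 * F ^+ 2] keeps the values of [w] within a ratio [4 / 3], which [weight_small] exploits. *)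
Let F := D + dl.
Let G := expR (beta * F).
Let a := 2 * G / dl ^+ 2.
Let w (d : R) := 3 * F ^+ 2 + Num.min d D * (2 * F - Num.min d D).

(* On [0, D] the concave part beats the fluctuations of the coupled pair of
   walks; beyond D the exponential part makes use of the drift. *)
Definition weight (d : R) : R := a * w d + expR (beta * d).

Definition weight_cap : R := a * (4 * F ^+ 2).

Let G0 : 0 < G. Proof. exact: expR_gt0. Qed.
Let a0 : 0 < a. Proof. by rewrite divr_gt0 ?exprn_gt0 ?mulr_gt0. Qed.
Let adl : a * dl ^+ 2 = 2 * G. Proof. by rewrite /a divfK// expf_neq0// gt_eqF. Qed.
Let aw x y : x <= y -> a * x <= a * y. Proof. by move=> ?; rewrite ler_wpM2l// ltW. Qed.

Let w_le d : 0 <= d -> w d <= 4 * F ^+ 2.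
Proof.
move=> d0; rewrite /w; set m := Num.min d D.
have : 0 <= (F - m) ^+ 2 by rewrite sqr_ge0.
by rewrite !expr2; lra.
Qed.

Let le_w d : 0 <= d -> 3 * F ^+ 2 <= w d.
Proof.
move=> d0; rewrite /w lerDl mulr_ge0//.
  by rewrite le_min d0; have := dlD; have := dl0; lra.
have : Num.min d D <= D by rewrite ge_min lexx orbT.
by rewrite /F; have := dlD; have := dl0; lra.
Qed.

Let expRG d : d <= F -> expR (beta * d) <= G.
Proof. by move=> dF; rewrite ler_expR ler_pM2l. Qed.

Lemma weight_ge_expR d : 0 <= d -> expR (beta * d) <= weight d.
Proof.
move=> d0; rewrite -[leLHS]add0r; apply: lerD => //.
by rewrite mulr_ge0 ?(ltW a0)// (le_trans _ (le_w d d0))// mulr_ge0// sqr_ge0.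
Qed.

Lemma weight_ge1 d : 0 <= d -> 1 <= weight d.
Proof.
move=> d0; apply: le_trans (weight_ge_expR d d0).
by rewrite -expR0 ler_expR mulr_ge0// ltW.
Qed.

Lemma weight_cap_ge0 : 0 <= weight_cap.
Proof. by rewrite mulr_ge0 ?(ltW a0)// mulr_ge0// sqr_ge0. Qed.

Lemma weight_le d : 0 <= d -> weight d <= weight_cap + expR (beta * d).
Proof. by move=> d0; rewrite lerD2r aw// w_le. Qed.

(** From [D] on [w] takes its maximum, so a change of distance can raise the exponential term
    only. *)
Lemma weight_geD d d' : 0 <= d' -> D <= d ->
  weight d' <= weight d - expR (beta * d) + expR (beta * d').
Proof.
move=> d'0 Dd; rewrite /weight addrK lerD2r aw//.
rewrite {2}/w min_r// /w lerD2l; set m := Num.min d' D.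
have mD : m <= D by rewrite ge_min lexx orbT.
have : 0 <= (D - m) * (2 * F - D - m).
  by rewrite mulr_ge0//; rewrite /F; have := dlD; have := dl0; lra.
by lra.
Qed.

(** The concavity gains [2 * G] on average and the exponentials at [d + dl] and [d - dl] cost at
    most [G]. Freezing [w] beyond [D] does no harm: it only lowers the value at [d + dl]. *)
Lemma weight_midpoint d : dl <= d -> d <= D ->
  (weight (d + dl) + weight (d - dl)) / 2 <= weight d - G.
Proof.
move=> dld dD.
have e1 : expR (beta * (d + dl)) <= G by apply: expRG; rewrite /F; lra.
have e2 : expR (beta * (d - dl)) <= G by apply: expRG; rewrite /F; have := dl0; lra.
have e3 := expR_gt0 (beta * d).
have h : w (d + dl) + w (d - dl) <= 2 * w d - 2 * dl ^+ 2.
  rewrite /w (min_l dD) (@min_l _ _ (d - dl)); last by have := dl0; lra.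
  set m := Num.min _ _; have md : m <= d + dl by rewrite ge_min lexx.
  have mD : m <= D by rewrite ge_min lexx orbT.
  have : 0 <= (d + dl - m) * (2 * F - (d + dl) - m).
    by rewrite mulr_ge0//; rewrite /F; have := dl0; lra.
  by rewrite !expr2; lra.
by have := aw _ _ h; have := adl; rewrite /weight; lra.
Qed.

(** At small distance the coupled pair meets with chance at least one half and is otherwise at
    distance [2 * dl]. Half of the largest value of [w] is below its smallest value by [F ^+ 2], and
    [a * F ^+ 2 >= 8 * G] because [F >= 2 * dl]. *)
Lemma weight_small d : 0 <= d -> d <= dl -> weight (dl + dl) / 2 <= weight d - G.
Proof.
move=> d0 ddl; have dl1 := dl0; have dD := dlD.
have h1 : weight (dl + dl) <= a * (4 * F ^+ 2) + G.
  apply: (le_trans (weight_le _ _)); first lra.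
  by rewrite lerD2l expRG// /F; lra.
have h2 := aw _ _ (le_w d d0).
have h3 : 4 * (a * dl ^+ 2) <= a * F ^+ 2.
  rewrite mulrCA aw//; have : 0 <= (F - 2 * dl) * (F + 2 * dl).
    by rewrite mulr_ge0// /F; lra.
  by rewrite !expr2; lra.
have := expR_gt0 (beta * d).
by have := adl; have := G0; rewrite /weight in h1 *; lra.
Qed.

Lemma weight_le_cap d : 0 <= d -> d <= D -> weight d <= weight_cap + G.
Proof.
move=> d0 dD; apply: (le_trans (weight_le d d0)).
by rewrite lerD2l expRG// /F; have := dl0; lra.
Qed.

End weight.

(** * One step of the coupling contracts the weighted distance *)

Section contraction.
Context {R : realType}.
Notation leb := (@lebesgue_measure R).

Variables (p : probability R R) (nu : {measure set R -> \bar R}) (phi q f : R -> R).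
Hypothesis mphi : measurable_fun setT phi.
Hypothesis phi0 : forall x, 0 <= phi x.
Hypothesis pE : forall A, measurable A ->
  (p A = nu A + \int[leb]_(x in A) (phi x)%:E)%E.
Hypothesis mq : measurable_fun setT q.
Hypothesis q0 : forall x, 0 <= q x.
Hypothesis f0 : forall x, 0 <= f x.
Hypothesis qE : forall y, ((q y)%:E = (f y)%:E + \int[p]_z (q (y - z))%:E)%E.

Variables (tau M s beta b0 dl D eta x0 T e0 : R).
Hypothesis tau0 : 0 < tau.
Hypothesis pM : (\int[p]_x (expR (tau * `|x|))%:E <= M%:E)%E.
Hypothesis s0 : 0 <= s.
Hypothesis beta0 : 0 < beta.
Hypothesis st : s <= tau / 2.
Hypothesis betat : beta <= tau / 2.
Hypothesis pbeta : (\int[p]_x (expR ((- beta) * x))%:E <= (1 - b0)%:E)%E.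
Hypothesis dl0 : 0 < dl.
Hypothesis dlD : dl <= D.
Hypothesis eta0 : 0 <= eta.
Hypothesis eta1 : eta * (2 * dl) <= 1.
Hypothesis phieta : forall x, x0 - dl <= x < x0 + dl -> eta <= phi x.
Hypothesis x0T : `|x0| <= T.
Hypothesis e00 : 0 < e0.
Hypothesis e0b : e0 <= b0.
Hypothesis se0 : s * (2 / tau) * M <= e0.
Hypothesis sTe0 : expR (s * (T + 3 * dl)) <= 1 + e0.
Let cap := weight_cap beta dl D.
Let G := expR (beta * (D + dl)).
Let W := weight beta dl D.
Hypothesis far : 2 * e0 * cap + M + e0 * expR (beta * D) <= b0 * expR (beta * D).
Hypothesis near : 3 * e0 * (cap + G) <= eta * (2 * dl) * G.

(** Left abstract because the iteration uses sums of [exp (- s x)] and [exp (s x)]. A jump [z]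
    changes the prefactor by a factor at most [exp (s |z|)], whose cost is kept below [e0]. *)
Variable E : R -> R.
Hypothesis E0 : forall x, 0 <= E x.
Hypothesis Ele : forall x y, E x <= E y * expR (s * `|x - y|).
Hypothesis qW : forall y y', `|q y - q y'| <= E (Num.min y y') * W `|y - y'|.

Let W1 d : 0 <= d -> 1 <= W d. Proof. exact: weight_ge1. Qed.

Let W0 d : 0 <= d -> 0 <= W d.
Proof. by move=> d0; rewrite (le_trans _ (W1 d d0)). Qed.

Let far_apart y y' : y' + D < y ->
  `|q y - q y'| <= f y + (1 - e0) * (E y' * W (y - y')).
Proof.
move=> yD; set d := y - y'; have dD : D <= d by rewrite /d; lra.
have dl1 := dl0; have dD1 := dlD; have b1 := beta0; have s1 := s0; have t1 := tau0.
have e1 := e00; have eb := e0b; have st' := st; have bt' := betat; have se := se0.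
have d0 : 0 <= d by lra.
set V := W d - expR (beta * d).
have WV d' : 0 <= d' -> W d' <= V + expR (beta * d').
  by move=> d'0; exact: weight_geD.
have V0 : 0 <= V.
  have := WV 0 (lexx _); have := W1 0 (lexx _); rewrite mulr0 expR0; lra.
have Vcap : V <= cap by rewrite lerBlDr; exact: weight_le.
pose U z := E y' * (V * expR (s * `|z|) + (expR (beta * d) * expR ((- beta) * z)
   + expR (tau * `|z|))).
have U0 z : 0 <= U z.
  apply: mulr_ge0 => //; apply: addr_ge0; first by apply: mulr_ge0 => //; exact: expR_ge0.
  by apply: addr_ge0; [apply: mulr_ge0|]; exact: expR_ge0.
have mU : measurable_fun setT U.
  apply: measurable_funM => //; apply: measurable_funD.
    by apply: measurable_funM => //; exact: measurable_expRMabs.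
  apply: measurable_funD; last exact: measurable_expRMabs.
  by apply: measurable_funM => //; exact: measurable_expRM.
apply: (step_one p q f mq q0 f0 qE U) => //.
  move=> z; apply: (le_trans (qW _ _)).
  have ez1 : V <= V * expR (s * `|z|).
    by rewrite ler_peMr// -expR0 ler_expR mulr_ge0.
  have [zd|dz] := leP z d.
    rewrite min_r; last by move: zd; rewrite /d; lra.
    rewrite ler_wpM2l// ger0_norm; last by move: zd; rewrite /d; lra.
    rewrite (_ : y - z - y' = d - z); last by rewrite /d; lra.
    apply: (le_trans (WV _ _)); first lra.
    apply: lerD => //; rewrite -expRD (_ : beta * d + _ = beta * (d - z)); last by ring.
    by rewrite lerDl expR_ge0.
  have zd0 : 0 <= z - d by lra.
  have zn : `|z| = z by rewrite ger0_norm//; lra.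
  have yzn : `|y - z - y'| = z - d.
    by rewrite ltr0_norm /d; [lra|move: dz; rewrite /d; lra].
  rewrite min_l; last by move: dz; rewrite /d; lra.
  apply: (@le_trans _ _ ((E y' * expR (s * (z - d))) * (V + expR (beta * (z - d))))).
    by rewrite ler_pM ?E0 ?W0 ?yzn ?WV// -yzn Ele.
  rewrite -mulrA ler_wpM2l// mulrDr; apply: lerD.
    rewrite mulrC ler_wpM2l// ler_expR zn ler_wpM2l//; lra.
  rewrite -expRD -mulrDl; apply: (@le_trans _ _ (expR (tau * `|z|))); last first.
    by rewrite lerDr mulr_ge0 ?expR_ge0.
  by rewrite ler_expR zn ler_pM//; lra.
have mexp r : measurable_fun setT (fun z : R => (expR (r * z))%:E).
  by apply/measurable_EFinP; exact: measurable_expRM.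
have mexpa r : measurable_fun setT (fun z : R => (expR (r * `|z|))%:E).
  by apply/measurable_EFinP; exact: measurable_expRMabs.
have es : (\int[p]_x (expR (s * `|x|))%:E <= (1 + s * (2 / tau) * M)%:E)%E.
  by apply: exp_moment_abs_le => //; exact: probability_le1.
apply: (@le_trans _ _ ((E y')%:E * (V%:E * (1 + s * (2 / tau) * M)%:E +
   ((expR (beta * d))%:E * (1 - b0)%:E + M%:E)))%E).
  under eq_integral do rewrite /U EFinM 2!EFinD !EFinM.
  have m1 := measurable_funeM V%:E (mexpa s).
  have m2 := measurable_funeM (expR (beta * d))%:E (mexp (- beta)).
  have m3 := emeasurable_funD m2 (mexpa tau).
  have m4 := emeasurable_funD m1 m3.
  have n1 (z : R) : setT z -> (0 <= V%:E * (expR (s * `|z|))%:E)%E by rewrite mule_ge0 ?lee_fin.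
  have n2 (z : R) : setT z -> (0 <= (expR (beta * d))%:E * (expR (- beta * z))%:E)%E.
    by rewrite mule_ge0.
  have n3 (z : R) : setT z -> (0 <= (expR (beta * d))%:E * (expR (- beta * z))%:E
      + (expR (tau * `|z|))%:E)%E by move=> zT; rewrite adde_ge0 ?n2.
  have n4 (z : R) : setT z -> (0 <= V%:E * (expR (s * `|z|))%:E + ((expR (beta * d))%:E *
      (expR (- beta * z))%:E + (expR (tau * `|z|))%:E))%E.
    by move=> zT; rewrite adde_ge0 ?n1 ?n3.
  have n5 (z : R) : setT z -> (0 <= (expR (tau * `|z|))%:E)%E by [].
  rewrite (ge0_integralZl p measurableT m4 n4) ?lee_fin//.
  rewrite (ge0_integralD p measurableT n1 m1 n3 m3).
  rewrite (ge0_integralD p measurableT n2 m2 n5 (mexpa tau)).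
  rewrite !ge0_integralZl//.
  apply: lee_wpmul2l; first by rewrite lee_fin.
  apply: leeD; first by apply: lee_wpmul2l; rewrite ?lee_fin.
  by apply: leeD => //; apply: lee_wpmul2l.
rewrite (_ : (_ * _)%E = (E y' * (V * (1 + s * (2 / tau) * M) +
  (expR (beta * d) * (1 - b0) + M)))%:E)// lee_fin [leRHS]mulrCA.
apply: ler_wpM2l => //.
have XD : expR (beta * D) <= expR (beta * d) by rewrite ler_expR ler_wpM2l// ltW.
have Wd : W d = V + expR (beta * d) by rewrite /V subrK.
rewrite Wd.
have h1 : 0 <= (b0 - e0) * (expR (beta * d) - expR (beta * D)).
  by rewrite mulr_ge0//; lra.
have h2 : 0 <= e0 * (cap - V) by rewrite mulr_ge0//; lra.
have h3 : 0 <= V * (e0 - s * (2 / tau) * M) by rewrite mulr_ge0//; lra.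
by have := far; lra.
Qed.

Let Emin y y' v v' : `|Num.min v v' - Num.min y y'| <= T + 3 * dl ->
  E (Num.min v v') <= E (Num.min y y') * (1 + e0).
Proof.
move=> vy; apply: (le_trans (Ele _ (Num.min y y'))); rewrite ler_wpM2l//.
by apply: le_trans sTe0; rewrite ler_expR ler_wpM2l.
Qed.

(** A uniform jump has size at most [T + dl] and the exchange displaces it by at most [2 * dl] more,
    hence [T + 3 * dl]; the minimum of two points moves no more than the points do. *)
Let q_le y y' v v' w : `|v - y| <= T + 3 * dl -> `|v' - y'| <= T + 3 * dl ->
  W `|v - v'| = w -> q v <= q v' + E (Num.min y y') * (1 + e0) * w.
Proof.
move=> vy vy' <-; have := qW v v'; rewrite ler_distl => /andP[_ h].
apply: (le_trans h); rewrite lerD2l; apply: ler_wpM2r; first exact: W0.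
apply: Emin; move: vy vy'; rewrite !ler_distl => /andP[h1 h2] /andP[h3 h4].
by rewrite !minElt; case: ltP => ?; case: ltP => ?; apply/andP; split; lra.
Qed.

(** The coupling gains [eta * (2 * dl) * G]. It pays three losses of relative size [e0]: the
    exponential moment of the remaining jump, the variation of [E] under the uniform jump, and the
    contraction factor [1 - e0] itself. This is the factor [3] in [near], applied with
    [W <= cap + G]. *)
Let step_mix y y' b w1 w2 : x0 - dl <= b -> b <= x0 + dl -> `|y - y'| <= D ->
  0 <= w1 -> 0 <= w2 ->
  (forall u, x0 - dl <= u <= b ->
    q (y - u) <= q (y' - (u + (x0 + dl - b))) + E (Num.min y y') * (1 + e0) * w1) ->
  (forall u, b <= u <= x0 + dl ->
    q (y - u) <= q (y' - (u - (b - (x0 - dl)))) + E (Num.min y y') * (1 + e0) * w2) ->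
  w1 * (b - (x0 - dl)) + w2 * (x0 + dl - b) <= 2 * dl * (W `|y - y'| - G) ->
  q y <= q y' + f y + (1 - e0) * (E (Num.min y y') * W `|y - y'|).
Proof.
move=> ab bc dD w10 w20 h1 h2 hw; set m := Num.min y y'; set d := `|y - y'| in dD hw *.
have d0 : 0 <= d by exact: normr_ge0.
have Em := E0 m; have e1 := e00; have Wd := W0 d d0.
have hz z : q (y - z) <= q (y' - z) + E m * W d * expR (s * `|z|).
  have := qW (y - z) (y' - z); rewrite ler_distl => /andP[_ h].
  apply: (le_trans h); rewrite lerD2l mulrAC (_ : y - z - (y' - z) = y - y'); last by ring.
  rewrite ler_wpM2r// (_ : Num.min _ _ = m - z); last by rewrite /m addr_minl.
  by rewrite (_ : `|z| = `|m - z - m|) ?Ele// -normrN; congr (`|_|); ring.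
have k0 : 0 <= E m * W d by exact: mulr_ge0.
have k10 : 0 <= E m * (1 + e0) * w1 by rewrite !mulr_ge0//; lra.
have k20 : 0 <= E m * (1 + e0) * w2 by rewrite !mulr_ge0//; lra.
have ac : x0 - dl <= x0 + dl by lra.
have hs := step_both p q f mq q0 f0 qE nu phi mphi phi0 pE eta _ _ eta0 ac phieta tau M s
  tau0 pM s0 st y y' b _ _ _ ab bc k0 k10 k20 hz h1 h2.
rewrite (_ : x0 + dl - (x0 - dl) = 2 * dl) in hs; last by ring.
apply: (le_trans hs).
have hw' : 0 <= (E m * (eta * (1 + e0))) * (2 * dl * (W d - G) - (w1 * (b - (x0 - dl)) + w2 * (x0 + dl - b))).
  by rewrite !mulr_ge0//; lra.
have WD : W d <= cap + G by exact: weight_le_cap.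
have H1 : 0 <= E m * (W d * (e0 * (1 - eta * (2 * dl)))).
  by rewrite !mulr_ge0//; [lra|have := eta1; lra].
have H2 : 0 <= E m * (W d * (e0 - s * (2 / tau) * M)).
  by rewrite !mulr_ge0//; have := se0; lra.
have H3 : 0 <= E m * (3 * e0 * (cap + G - W d)).
  by rewrite !mulr_ge0//; lra.
have H4 : 0 <= E m * (eta * (2 * dl) * G - 3 * e0 * (cap + G)).
  by rewrite mulr_ge0//; have := near; lra.
have H5 : 0 <= E m * (e0 * (eta * (2 * dl) * G)).
  by rewrite !mulr_ge0//; [lra|have := dl0; lra|exact: expR_ge0].
by lra.
Qed.

Let close_pair y y' : y != y' -> `|y - y'| <= D ->
  q y <= q y' + f y + (1 - e0) * (E (Num.min y y') * W `|y - y'|).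
Proof.
move=> yy' dD; have dl1 := dl0.
have := x0T; rewrite ler_norml => /andP[x1 x2].
have bnd u : x0 - dl <= u <= x0 + dl -> - (T + dl) <= u <= T + dl.
  by move=> /andP[? ?]; apply/andP; split; lra.
have [dld|ddl] := leP dl `|y - y'|.
  (* With [b] at the midpoint the two blocks have equal length, and the signed distance becomes
     [y - y' + dl] or [y - y' - dl]. *)
  apply: (step_mix y y' x0 (W `|y - y' + dl|) (W `|y - y' - dl|)) => //; rewrite ?W0//; try lra.
  - move=> u /andP[u1 u2]; have /bnd /andP[u3 u4] : x0 - dl <= u <= x0 + dl.
      by apply/andP; split; lra.
    apply: q_le; rewrite ?ler_norml; try (apply/andP; split; lra).
    by congr (W `|_|); ring.
  - move=> u /andP[u1 u2]; have /bnd /andP[u3 u4] : x0 - dl <= u <= x0 + dl.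
      by apply/andP; split; lra.
    apply: q_le; rewrite ?ler_norml; try (apply/andP; split; lra).
    by congr (W `|_|); ring.
  - have := weight_midpoint beta dl D beta0 dl0 `|y - y'| dld dD; rewrite -/W -/G => h.
    have {}h : 2 * dl * ((W (`|y - y'| + dl) + W (`|y - y'| - dl)) / 2) <=
        2 * dl * (W `|y - y'| - G) by rewrite ler_wpM2l//; lra.
    apply: le_trans h.
    suff h5 : W `|y - y' + dl| + W `|y - y' - dl| = W (`|y - y'| + dl) + W (`|y - y'| - dl).
      by have /= := congr1 (fun v => dl * v) h5; lra.
    have [t0|t0] := leP 0 (y - y').
      rewrite (ger0_norm t0) in dld *.
      by rewrite !ger0_norm//; lra.
    rewrite (ltr0_norm t0) in dld *; rewrite addrC.
    by congr (W _ + W _); rewrite ler0_norm; lra.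
have h := weight_small beta dl D beta0 dl0 dlD `|y - y'| (normr_ge0 _) (ltW ddl).
rewrite -/W -/G in h.
have h0 : 0 <= W `|y - y'| - G.
  by apply: le_trans h; rewrite divr_ge0// W0//; lra.
have W2 := W0 (dl + dl).
have h' := ler_wpM2l (ltW dl1) h.
have [t0|t0] := ltP 0 (y - y').
  rewrite (gtr0_norm t0) in ddl h' h0.
  (* The first block has length [y - y'], so on the second the displacement cancels the distance and
     the values of [q] coincide. On the first, of relative length at most one half, the distance
     becomes exactly [2 * dl]. *)
  apply: (step_mix y y' (x0 - dl + (y - y')) (W (dl + dl)) 0) => //; try lra.
  - move=> u /andP[u1 u2]; have /bnd /andP[u3 u4] : x0 - dl <= u <= x0 + dl.
      by apply/andP; split; lra.
    apply: q_le; rewrite ?ler_norml; try (apply/andP; split; lra).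
    by congr W; rewrite ger0_norm; lra.
  - move=> u _; rewrite mulr0 addr0 le_eqVlt; apply/orP; left; apply/eqP.
    by congr q; ring.
  - rewrite (gtr0_norm t0); have : 0 <= W (dl + dl) * (dl - (y - y')).
      by rewrite mulr_ge0//; [apply: W2|]; lra.
    by have : 0 <= dl * (W (y - y') - G) by [rewrite mulr_ge0//; lra]; lra.
have {}t0 : y - y' < 0 by rewrite lt_neqAle t0 subr_eq0 yy'.
rewrite (ltr0_norm t0) in ddl h' h0.
apply: (step_mix y y' (x0 + dl + (y - y')) 0 (W (dl + dl))) => //; try lra.
- move=> u _; rewrite mulr0 addr0 le_eqVlt; apply/orP; left; apply/eqP.
  by congr q; ring.
- move=> u /andP[u1 u2]; have /bnd /andP[u3 u4] : x0 - dl <= u <= x0 + dl.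
    by apply/andP; split; lra.
  apply: q_le; rewrite ?ler_norml; try (apply/andP; split; lra).
  by congr W; rewrite ler0_norm; lra.
- rewrite (ltr0_norm t0); have : 0 <= W (dl + dl) * (dl + (y - y')).
    by rewrite mulr_ge0//; [apply: W2|]; lra.
  by have : 0 <= dl * (W (- (y - y')) - G) by [rewrite mulr_ge0//; lra]; lra.
Qed.

Lemma coupling_contraction y y' : `|q y - q y'| <=
  f y + f y' + (1 - e0) * (E (Num.min y y') * W `|y - y'|).
Proof.
have fy := f0 y; have fy' := f0 y'.
have e1 : 0 <= 1 - e0.
  have : 0 <= 1 - b0.
    rewrite -lee_fin; apply: le_trans pbeta.
    by apply: integral_ge0 => x _; rewrite lee_fin expR_ge0.
  by have := e0b; lra.
have EW0 : 0 <= (1 - e0) * (E (Num.min y y') * W `|y - y'|).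
  by rewrite !mulr_ge0// W0.
have [yy|yy'] := eqVneq y y'.
  by rewrite [q y]/= {1}yy subrr normr0; lra.
have [dD|Dd] := leP `|y - y'| D.
  rewrite ler_distl; apply/andP; split; last by have := close_pair y y' yy' dD; lra.
  have := close_pair y' y; rewrite eq_sym yy' distrC dD minC => /(_ isT isT).
  by rewrite distrC; lra.
have [y'y|y'y] := ltP y' y.
  have t0 : 0 < y - y' by rewrite subr_gt0.
  have yD : y' + D < y by move: Dd; rewrite (gtr0_norm t0); lra.
  have := far_apart y y' yD; rewrite (gtr0_norm t0); lra.
have t0 : 0 < y' - y by rewrite subr_gt0 lt_neqAle yy'.
have yD : y + D < y' by move: Dd; rewrite distrC (gtr0_norm t0); lra.
have := far_apart y' y yD; rewrite (distrC (q y)) (distrC y) (gtr0_norm t0); lra.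
Qed.

End contraction.

(** * From the contraction to exponentially small oscillation *)

Section oscillation.
Context {R : realType}.
Variables (q f : R -> R) (s beta e0 B C : R) (W : R -> R).
Hypothesis q0 : forall x, 0 <= q x.
Hypothesis s0 : 0 < s.
Hypothesis sbeta : s <= beta.
Hypothesis e0gt0 : 0 < e0.
Hypothesis e0lt1 : e0 < 1.
Hypothesis B0 : 0 <= B.
Hypothesis C0 : 0 <= C.
Hypothesis Wexp : forall d, 0 <= d -> expR (beta * d) <= W d.
Hypothesis qB : forall x, q x <= B * expR (s * x).
Hypothesis fC : forall x, f x <= C * expR (- s * x).
Hypothesis contraction : forall E : R -> R, (forall x, 0 <= E x) ->
  (forall x y, E x <= E y * expR (s * `|x - y|)) ->
  (forall y y', `|q y - q y'| <= E (Num.min y y') * W `|y - y'|) ->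
  forall y y', `|q y - q y'| <=
    f y + f y' + (1 - e0) * (E (Num.min y y') * W `|y - y'|).

Let W1 d : 0 <= d -> 1 <= W d.
Proof.
move=> d0; apply: le_trans (Wexp d d0).
by rewrite -expR0 ler_expR mulr_ge0//; have := s0; have := sbeta; lra.
Qed.

Let fmin y y' : f y + f y' <= 2 * C * expR (- s * Num.min y y') * W `|y - y'|.
Proof.
have h y1 : Num.min y y' <= y1 -> f y1 <= C * expR (- s * Num.min y y').
  move=> my; apply: (le_trans (fC y1)); rewrite ler_wpM2l// ler_expR !mulNr lerN2.
  by rewrite ler_wpM2l// ltW.
have h1 : f y + f y' <= 2 * C * expR (- s * Num.min y y').
  have := h y; have := h y'; rewrite !ge_min !lexx orbT => /(_ isT) ? /(_ isT) ?; lra.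
apply: (le_trans h1); rewrite ler_peMr ?W1//.
by rewrite mulr_ge0 ?expR_ge0// mulr_ge0.
Qed.

(* The a priori bound, with the growing weight exp (s min), is contracted away. *)
Let iterate n y y' : `|q y - q y'| <=
  (2 * C / e0 * expR (- s * Num.min y y') +
   B * (1 - e0) ^+ n * expR (s * Num.min y y')) * W `|y - y'|.
Proof.
have e1 := e0gt0; have e2 := e0lt1; have s1 := s0.
have A0 : 0 <= 2 * C / e0 by rewrite divr_ge0 ?mulr_ge0// ltW.
elim: n y y' => [|n IHn] y y'.
  rewrite expr0 mulr1; apply: (@le_trans _ _ (B * expR (s * Num.min y y') * W `|y - y'|)).
    wlog yy' : y y' / y <= y'.
      move=> h; case/orP: (le_total y y') => [/h//|/h H].
      by rewrite (distrC (q y)) (distrC y) minC.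
    rewrite min_l//; apply: (@le_trans _ _ (B * expR (s * y'))).
      have := q0 y; have := q0 y'; have := qB y; have := qB y' => h1 h2 h3 h4.
      have h5 : B * expR (s * y) <= B * expR (s * y').
        by rewrite ler_wpM2l// ler_expR ler_wpM2l// ltW.
      by rewrite ler_distl; apply/andP; split; lra.
    rewrite -mulrA ler_wpM2l// distrC ger0_norm ?subr_ge0//.
    (* The a priori bound sits at the larger point; the growth from the minimum to it is absorbed by
       the weight, because [s <= beta]. *)
    apply: (@le_trans _ _ (expR (s * y) * expR (s * (y' - y)))).
      by rewrite -expRD ler_expR; lra.
    rewrite ler_wpM2l ?expR_ge0//; apply: le_trans (Wexp _ _); last by rewrite subr_ge0.
    by rewrite ler_expR ler_wpM2r// subr_ge0.
  rewrite ler_wpM2r//; first by rewrite (le_trans _ (W1 _ _)).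
  by rewrite lerDr mulr_ge0// expR_ge0.
pose E x := 2 * C / e0 * expR (- s * x) + B * (1 - e0) ^+ n * expR (s * x).
have Bn0 : 0 <= B * (1 - e0) ^+ n by rewrite mulr_ge0// exprn_ge0//; lra.
have E0 x : 0 <= E x by rewrite addr_ge0// mulr_ge0// expR_ge0.
have Ele x y1 : E x <= E y1 * expR (s * `|x - y1|).
  rewrite /E [leRHS]mulrDl; apply: lerD.
    rewrite -[leRHS]mulrA; apply: ler_wpM2l => //; rewrite -expRD ler_expR.
    have := ler_norm (- (x - y1)); rewrite normrN => h.
    by have := ler_wpM2l (ltW s1) h; lra.
  rewrite -[leRHS]mulrA; apply: ler_wpM2l => //; rewrite -expRD ler_expR.
  by have := ler_wpM2l (ltW s1) (ler_norm (x - y1)); lra.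
apply: (le_trans (contraction E E0 Ele IHn y y')).
have h := fmin y y'.
(* [2 * C / e0] is the fixed point of [A = (1 - e0) * A + 2 * C], so the decaying term reproduces
   itself while the growing one loses a factor [1 - e0]. *)
have AE : 2 * C / e0 * e0 = 2 * C by rewrite divfK// gt_eqF.
rewrite /E exprS; set A := 2 * C / e0 in AE *.
by move: h; rewrite -AE; lra.
Qed.

Lemma coupling_bound y y' : `|q y - q y'| <=
  2 * C / e0 * expR (- s * Num.min y y') * W `|y - y'|.
Proof.
apply/ler_addgt0Pr => e epos.
set K := B * expR (s * Num.min y y') * W `|y - y'|.
have K0 : 0 <= K.
  by rewrite !mulr_ge0 ?expR_ge0// (le_trans _ (W1 _ _)).
have : (fun n => K * (1 - e0) ^+ n) @ \oo --> K * 0.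
  apply: cvgMr; apply: cvg_expr.
  by rewrite ger0_norm; have := e0gt0; have := e0lt1; lra.
rewrite mulr0 => /cvgrPdist_le /(_ e epos) [n _ /(_ n (leqnn n))] /=.
rewrite sub0r normrN ger0_norm; last first.
  by rewrite mulr_ge0// exprn_ge0//; have := e0lt1; lra.
by have := iterate n y y'; rewrite /K; lra.
Qed.

(** [coupling_bound] deteriorates with the distance through the weight. It is used only at distance
    at most [1], and larger distances are crossed by unit steps whose bounds form a geometric series
    of ratio [exp (- s)]. *)
Lemma oscillation_le Wm : (forall d, 0 <= d <= 1 -> W d <= Wm) -> forall y y',
  `|q y - q y'| <= 2 * C / e0 * Wm / (1 - expR (- s)) * expR (- s * Num.min y y').
Proof.
move=> WWm; set r := expR (- s); set K := 2 * C / e0 * Wm.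
have r1 : r < 1 by rewrite /r -expR0 ltr_expR oppr_lt0.
have r0 : 0 < r by exact: expR_gt0.
have Wm0 : 0 <= Wm.
  have h01 : (0 : R) <= 0 <= (1 : R) by rewrite lexx ler01.
  by have := W1 0 (lexx 0); have := WWm 0 h01; lra.
have A0 : 0 <= 2 * C / e0 by rewrite divr_ge0 ?mulr_ge0// ltW.
have K0 : 0 <= K by exact: mulr_ge0.
have Kr : K / (1 - r) = K + K / (1 - r) * r by field; lra.
have Kr0 : 0 <= K / (1 - r) by rewrite divr_ge0//; lra.
have near1 y y' : y <= y' -> y' <= y + 1 -> `|q y - q y'| <= K * expR (- s * y).
  move=> yy' y'1; apply: (le_trans (coupling_bound y y')).
  rewrite min_l// mulrAC ler_wpM2r ?expR_ge0// ler_wpM2l// WWm//.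
  by rewrite distrC ger0_norm ?subr_ge0//; apply/andP; split; lra.
have far n y y' : y <= y' -> y' <= y + n%:R -> `|q y - q y'| <= K / (1 - r) * expR (- s * y).
  elim: n y => [|n IHn] y yy' y'n.
    have -> : y' = y by move: y'n; rewrite addr0; lra.
    by rewrite subrr normr0 mulr_ge0 ?expR_ge0.
  have ey := expR_ge0 (- s * y).
  have [y1|y1] := leP y' (y + 1).
    apply: (le_trans (near1 _ _ yy' y1)); rewrite ler_wpM2r//.
    by rewrite [leRHS]Kr lerDl mulr_ge0// ltW.
  rewrite -(subrKA (q (y + 1))) (le_trans (ler_normD _ _))//.
  have h1 := near1 y (y + 1) (ltac:(lra)) (lexx _).
  have h2 := IHn (y + 1) (ltW y1) (ltac:(move: y'n; rewrite mulrSr; lra)).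
  have e1 : expR (- s * (y + 1)) = r * expR (- s * y).
    by rewrite /r -expRD; congr expR; ring.
  move: h2; rewrite e1 mulrA => h2.
  rewrite [X in _ <= X * _]Kr mulrDl; exact: lerD.
move=> y y'; wlog yy' : y y' / y <= y'.
  move=> h; case/orP: (le_total y y') => [/h//|/h H].
  by rewrite (distrC (q y)) minC.
rewrite min_l//; apply: (far (Num.truncn (y' - y)).+1) => //.
by rewrite -lerBlDl ltW// truncnS_gt.
Qed.

End oscillation.

(** * The limit of the renewal density *)

Section exponential_integrals.
Context {R : realType}.
Notation leb := (@lebesgue_measure R).

Let continuous_expRM (r : R) : continuous (fun x : R => expR (r * x)).
Proof.
move=> x; apply: continuous_comp; last exact: continuous_expR.
exact: mulrl_continuous.
Qed.

Lemma integral_expR_itvcy (r a : R) : 0 < r ->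
  (\int[leb]_(x in `[a, +oo[) (expR (- r * x))%:E = (expR (- r * a) / r)%:E)%E.
Proof.
move=> r0; rewrite (@ge0_continuous_FTC2y _ _ (fun x => - (expR (- r * x) / r)) _ 0).
- by rewrite -EFinB; congr EFin; lra.
- by move=> x _; exact: expR_ge0.
- by apply: continuous_subspaceT; exact: continuous_expRM.
- rewrite -oppr0; apply: cvgN; rewrite -(mul0r r^-1); apply: cvgMl.
  rewrite (_ : (fun x => expR (- r * x)) = (fun z => expR (- z)) \o (fun z => r * z)).
    apply: (@cvg_comp _ _ _ _ _ _ (pinfty_nbhs R)); last exact: cvgr_expR.
    exact: gt0_cvgMry.
  by apply/funext => x /=; rewrite mulNr.
- move=> x _; exact: ex_derive.
- apply: cvg_at_right_filter; apply: cvgN; apply: cvgMl; exact: continuous_expRM.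
- move=> x _; rewrite derive1E derive_val.
  rewrite scaler0 add0r /GRing.scale /= mulr1 mulrN mulrN opprK mulrCA mulVf ?mulr1//.
  exact: lt0r_neq0.
Qed.

Lemma integral_expR_itvNyc (r a : R) : 0 < r ->
  (\int[leb]_(x in `]-oo, a]) (expR (r * x))%:E = (expR (r * a) / r)%:E)%E.
Proof.
move=> r0; rewrite -[in LHS](opprK a) ge0_integration_by_substitutionNy.
- under eq_integral do rewrite /= mulrN -mulNr.
  by rewrite integral_expR_itvcy// mulrNN.
- by apply: continuous_subspaceT; exact: continuous_expRM.
- by move=> x _; exact: expR_ge0.
Qed.

End exponential_integrals.

Section abel.
Context {R : realType}.
Notation leb := (@lebesgue_measure R).

(** Stands for the passage to the limit as [e] tends to [0] in the Abelian argument. *)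
Lemma ler_of_small (a b k d : R) : 0 < d -> 0 <= k ->
  (forall e, 0 < e -> e <= d -> a <= b + e * k) -> a <= b.
Proof.
move=> d0 k0 h; apply/ler_addgt0Pr => e e0.
have [k1|k1] := eqVneq k 0; first by have := h d d0 (lexx d); rewrite k1; lra.
have kp : 0 < k by rewrite lt_neqAle eq_sym k1.
have m0 : 0 < Num.min d (e / k) by rewrite lt_min d0 divr_gt0.
apply: (le_trans (h _ m0 _)); first by rewrite ge_min lexx.
by rewrite lerD2l -ler_pdivlMr// ge_min lexx orbT.
Qed.

Variables (p : probability R R) (nu : {finite_measure set R -> \bar R}) (phi q f : R -> R).
Hypothesis mphi : measurable_fun setT phi.
Hypothesis phi0 : forall x, 0 <= phi x.
Hypothesis pE : forall A, measurable A ->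
  (p A = nu A + \int[leb]_(x in A) (phi x)%:E)%E.
Hypothesis mq : measurable_fun setT q.
Hypothesis q0 : forall x, 0 <= q x.
Hypothesis mf : measurable_fun setT f.
Hypothesis f0 : forall x, 0 <= f x.
Hypothesis qE : forall y, ((q y)%:E = (f y)%:E + \int[p]_z (q (y - z))%:E)%E.
Hypothesis fE : forall y, ((f y)%:E = (phi y)%:E + \int[nu]_z (f (y - z))%:E)%E.

Let laplace (h : R -> R) (e : R) : \bar R := (\int[leb]_x (h x * expR (- e * x))%:E)%E.

Let laplace_ge0 h e : (forall x, 0 <= h x) -> (0 <= laplace h e)%E.
Proof. by move=> h0; apply: integral_ge0 => x _; rewrite lee_fin mulr_ge0// expR_ge0. Qed.

Let measurable_laplace (h : R -> R) e : measurable_fun setT h ->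
  measurable_fun setT (fun x => (h x * expR (- e * x))%:E).
Proof.
by move=> mh; apply/measurable_EFinP; apply: measurable_funM => //; exact: measurable_expRM.
Qed.

Let laplaceE (h : R -> R) (e y : R) : (forall x, 0 <= h x) -> measurable_fun setT h ->
  fconv (EFin \o h) (fun x => (expR (e * x))%:E) y = ((expR (e * y))%:E * laplace h e)%E.
Proof.
move=> h0 mh; rewrite /laplace -ge0_integralZl//.
- apply: eq_integral => x _; rewrite -!EFinM; congr EFin.
  by rewrite mulrCA -expRD; congr (_ * expR _); ring.
- exact: measurable_laplace.
- by move=> x _; rewrite lee_fin mulr_ge0// expR_ge0.
Qed.

(** The transform of [h] at [e] is the value at [0] of its convolution with [exp (e x)], so the
    product rule follows from [mconv_fconvl]. *)
Let laplace_mconv (m : {finite_measure set R -> \bar R}) (h k : R -> R) e (a l : R) :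
  measurable_fun setT h -> (forall x, 0 <= h x) ->
  (forall y, (k y)%:E = mconv m (EFin \o h) y)%E ->
  (\int[m]_x (expR (- e * x))%:E = a%:E)%E -> laplace h e = l%:E ->
  laplace k e = (l * a)%:E.
Proof.
move=> mh h0 kE ma hl.
have mE : measurable_fun setT (fun x : R => (expR (e * x))%:E).
  by apply/measurable_EFinP; exact: measurable_expRM.
have mhE : measurable_fun setT (EFin \o h) by exact/measurable_EFinP.
have l0 : 0 <= l by rewrite -lee_fin -hl; exact: laplace_ge0.
transitivity (fconv (mconv m (EFin \o h)) (fun x => (expR (e * x))%:E) 0).
  by apply: eq_integral => x _; rewrite -kE -EFinM sub0r mulrN mulNr.
rewrite -mconv_fconvl//.
transitivity (mconv m (fun x => (l * expR (e * x))%:E) 0).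
  by apply: eq_integral => x _; rewrite laplaceE// hl -EFinM mulrC.
by rewrite mconv_expR// ma -EFinM mulr0 expR0 mulr1.
Qed.

Variables (s B K k1 g mu : R).
Hypothesis s0 : 0 < s.
Hypothesis B0 : 0 <= B.
Hypothesis K0 : 0 <= K.
Hypothesis k10 : 0 <= k1.
Hypothesis g1 : g < 1.
Hypothesis mu0 : 0 < mu.
Hypothesis qB : forall x, q x <= B * expR (s * x).
Hypothesis osc : forall y y', `|q y - q y'| <= K * expR (- s * Num.min y y').
Hypothesis pm : forall e, 0 < e -> e <= s ->
  exists2 m, (\int[p]_x (expR (- e * x))%:E = m%:E)%E & `|1 - m - e * mu| <= e ^+ 2 * k1.
Hypothesis nug : forall e, 0 < e -> e <= s -> (\int[nu]_x (expR (- e * x))%:E <= g%:E)%E.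

(** Left of [y] the a priori bound is integrable since [e < s], and contributes a constant
    independent of [e]. Right of [y] the oscillation bound keeps [q] near [q y], which produces the
    pole [1 / e]. *)
Let laplace_q_le (y e : R) : 0 < y -> 0 < e -> e <= s / 2 ->
  (laplace q e <= (B * expR (s * y) / (s / 2) + (q y + K * expR (- s * y)) / e)%:E)%E.
Proof.
move=> y0 e0 es; have s1 := s0.
have se : 0 < s - e by lra.
have mq' := measurable_laplace q e mq.
rewrite /laplace -(setUv `]-oo, y]%classic) ge0_integral_setU//=; last 4 first.
- exact: measurableC.
- by rewrite setUv.
- by move=> x _; rewrite lee_fin mulr_ge0// expR_ge0.
- exact/disj_setPCl.
rewrite EFinD; apply: leeD.
  apply: (@le_trans _ _ (\int[leb]_(x in `]-oo, y]) (B%:E * (expR ((s - e) * x))%:E))%E).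
    apply: ge0_le_integral => //.
    - by move=> x _; rewrite lee_fin mulr_ge0// expR_ge0.
    - exact: (measurable_funTS mq').
    - by apply: measurable_funTS; apply: measurable_funeM; apply/measurable_EFinP; exact: measurable_expRM.
    - move=> x _; rewrite -EFinM lee_fin mulrBl expRD mulrA -mulNr.
      by rewrite ler_wpM2r ?expR_ge0.
  rewrite ge0_integralZl//; last first.
    by apply: measurable_funTS; apply/measurable_EFinP; exact: measurable_expRM.
  rewrite integral_expR_itvNyc// -EFinM lee_fin mulrA ler_pM ?mulr_ge0 ?expR_ge0 ?invr_ge0//.
  - exact: ltW.
  - by rewrite ler_wpM2l// ler_expR ler_wpM2r//; lra.
  - by rewrite lef_pV2 ?posrE//; lra.
rewrite setCitvl.
have k0 : 0 <= q y + K * expR (- s * y) by rewrite addr_ge0 ?mulr_ge0 ?expR_ge0.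
apply: (@le_trans _ _ (\int[leb]_(x in `[y, +oo[) ((q y + K * expR (- s * y))%:E * (expR (- e * x))%:E))%E).
  rewrite integral_itv_obnd_cbnd; last exact: (measurable_funTS mq').
  apply: ge0_le_integral => //.
  - by move=> x _; rewrite lee_fin mulr_ge0// expR_ge0.
  - exact: (measurable_funTS mq').
  - by apply: measurable_funTS; apply: measurable_funeM; apply/measurable_EFinP; exact: measurable_expRM.
  - move=> x /=; rewrite in_itv/= andbT => yx; rewrite -EFinM lee_fin ler_wpM2r ?expR_ge0//.
    have := osc x y; rewrite min_r// ler_distl => /andP[_]; lra.
rewrite ge0_integralZl//; last first.
  by apply: measurable_funTS; apply/measurable_EFinP; exact: measurable_expRM.
rewrite integral_expR_itvcy// -EFinM lee_fin ler_wpM2l// ler_pdivrMr// mulVf ?gt_eqF//.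
by rewrite -expR0 ler_expR mulNr oppr_le0 mulr_ge0// ltW.
Qed.

Let le_laplace_q (y e : R) : 0 < e -> 0 <= q y - K * expR (- s * y) ->
  (((q y - K * expR (- s * y)) * (expR (- e * y) / e))%:E <= laplace q e)%E.
Proof.
move=> e0 k0; have mq' := measurable_laplace q e mq.
rewrite EFinM -integral_expR_itvcy// -ge0_integralZl//; last first.
  by apply: measurable_funTS; apply/measurable_EFinP; exact: measurable_expRM.
apply: (@le_trans _ _ (\int[leb]_(x in `[y, +oo[) (q x * expR (- e * x))%:E)%E).
  apply: ge0_le_integral => //.
  - by move=> x _; rewrite mule_ge0.
  - by apply: measurable_funTS; apply: measurable_funeM; apply/measurable_EFinP; exact: measurable_expRM.
  - exact: (measurable_funTS mq').
  - move=> x /=; rewrite in_itv/= andbT => yx; rewrite -EFinM lee_fin ler_wpM2r ?expR_ge0//.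
    have := osc x y; rewrite min_r// ler_distl => /andP[]; lra.
apply: ge0_subset_integral => //.
by move=> x _; rewrite lee_fin mulr_ge0// expR_ge0.
Qed.

(* The Laplace transform at e of f is 1 + O(e) and that of q is (q y +- C) / e + O(1). *)
Lemma dist_renewal_limit (y : R) : 0 < y -> `|q y - mu^-1| <= K * expR (- s * y).
Proof.
move=> y0; have s1 := s0; have k1' := k10; have mu1 := mu0; have g1' := g1.
set k := K * expR (- s * y).
have k0 : 0 <= k by rewrite mulr_ge0 ?expR_ge0.
set C := B * expR (s * y) / (s / 2).
have C0 : 0 <= C by rewrite divr_ge0 ?mulr_ge0 ?expR_ge0//; lra.
have qy0 := q0 y.
(* The bound [mu / (k1 + 1)] gives [e * k1 < mu], hence a transform [m] of [p] strictly below [1];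
   [s / 2] is the range of [laplace_q_le]. *)
pose d := Num.min (Num.min 1 (s / 2)) (mu / (k1 + 1)).
have kp : 0 < k1 + 1 by lra.
have d0 : 0 < d by rewrite !lt_min ltr01 !divr_gt0.
have fq x : f x <= q x by rewrite -lee_fin qE leeDl// integral_ge0// => z _; rewrite lee_fin.
have phif x : phi x <= f x by rewrite -lee_fin fE leeDl// integral_ge0// => z _; rewrite lee_fin.
(* All transforms are first shown finite, through [phi <= f <= q], so that the equations can be
   solved. With [n] and [m] the transforms of [nu] and [p], that of [phi] is [m - n], so [Lf = (m -
   n) / (1 - n) = 1 - (1 - m) / (1 - n)], and [n <= g] gives the lower bound. *)
have main e : 0 < e -> e <= d -> exists m Lq Lf, [/\ laplace q e = Lq%:E,
    0 < 1 - m, `|1 - m - e * mu| <= e ^+ 2 * k1 &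
    [/\ Lq * (1 - m) = Lf, Lf <= 1 & 1 - (1 - m) / (1 - g) <= Lf]].
  move=> e0; rewrite !le_min => /andP[/andP[e1 es] em].
  have es' : e <= s by lra.
  have [m pmE mB] := pm e e0 es'.
  have Lq_fin : laplace q e \is a fin_num.
    by rewrite ge0_fin_numE ?laplace_ge0// (le_lt_trans (laplace_q_le y e y0 e0 es))// ltry.
  have Lsub (h1 h2 : R -> R) : measurable_fun setT h1 -> measurable_fun setT h2 ->
      (forall x, 0 <= h1 x) -> (forall x, h1 x <= h2 x) -> (laplace h1 e <= laplace h2 e)%E.
    move=> m1 m2 h10 h12; apply: ge0_le_integral => //.
    - by move=> x _; rewrite lee_fin mulr_ge0// expR_ge0.
    - exact: measurable_laplace.
    - exact: measurable_laplace.
    - by move=> x _; rewrite lee_fin ler_wpM2r ?expR_ge0.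
  have Lf_fin : laplace f e \is a fin_num.
    rewrite ge0_fin_numE ?laplace_ge0// (le_lt_trans (Lsub f q _ _ _ _))//.
    by rewrite -(fineK Lq_fin) ltry.
  have Lphi_fin : laplace phi e \is a fin_num.
    rewrite ge0_fin_numE ?laplace_ge0// (le_lt_trans (Lsub phi f _ _ _ _))//.
    by rewrite -(fineK Lf_fin) ltry.
  set n := fine (\int[nu]_x (expR (- e * x))%:E)%E.
  have n_fin : (\int[nu]_x (expR (- e * x))%:E)%E \is a fin_num.
    rewrite ge0_fin_numE ?integral_ge0// ?(le_lt_trans (nug e e0 es'))// ?ltry//.
  have nE : (\int[nu]_x (expR (- e * x))%:E = n%:E)%E by rewrite /n fineK.
  have n0 : 0 <= n by rewrite -lee_fin -nE integral_ge0// => x _; rewrite lee_fin expR_ge0.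
  have ng : n <= g by rewrite -lee_fin -nE nug.
  set Lq := fine (laplace q e); set Lf := fine (laplace f e).
  set Lphi := fine (laplace phi e).
  have LD (h h1 h2 : R -> R) (l l1 l2 : R) : measurable_fun setT h1 -> measurable_fun setT h2 ->
      (forall x, 0 <= h1 x) -> (forall x, 0 <= h2 x) -> (forall x, h x = h1 x + h2 x) ->
      laplace h e = l%:E -> laplace h1 e = l1%:E -> laplace h2 e = l2%:E -> l = l1 + l2.
    move=> m1 m2 h10 h20 hE hl hl1 hl2; apply: EFin_inj; rewrite EFinD -hl -hl1 -hl2.
    rewrite /laplace -ge0_integralD//.
    - by apply: eq_integral => x _; rewrite hE mulrDl EFinD.
    - by move=> x _; rewrite lee_fin mulr_ge0// expR_ge0.
    - exact: measurable_laplace.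
    - by move=> x _; rewrite lee_fin mulr_ge0// expR_ge0.
    - exact: measurable_laplace.
  have Eq : Lq = Lf + Lq * m.
    apply: (LD q f (fun x => q x - f x)) => //.
    - exact: measurable_funB.
    - by move=> x; rewrite subr_ge0.
    - by move=> x; rewrite addrC subrK.
    - by rewrite fineK.
    - by rewrite fineK.
    - apply: (laplace_mconv p q) => //; last by rewrite fineK.
      by move=> x; rewrite EFinB qE (addeC (f x)%:E) addeK.
  have Ef : Lf = Lphi + Lf * n.
    apply: (LD f phi (fun x => f x - phi x)) => //.
    - exact: measurable_funB.
    - by move=> x; rewrite subr_ge0.
    - by move=> x; rewrite addrC subrK.
    - by rewrite fineK.
    - by rewrite fineK.
    - apply: (laplace_mconv nu f) => //; last by rewrite fineK.
      by move=> x; rewrite EFinB fE (addeC (phi x)%:E) addeK.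
  have Em : m = n + Lphi.
    apply: EFin_inj; rewrite EFinD -pmE -nE /Lphi fineK//.
    rewrite (ge0_integral_density p nu phi)//.
      by apply/measurable_EFinP; exact: measurable_expRM.
  have m1 : 0 < 1 - m.
    have : e * (e * k1) < e * mu.
      rewrite ltr_pM2l//; move: em; rewrite ler_pdivlMr// => em.
      by have : e * k1 < e * (k1 + 1) by [rewrite ltr_pM2l//; lra]; lra.
    by move: mB; rewrite ler_distl => /andP[]; rewrite expr2 -mulrA; lra.
  exists m, Lq, Lf; split => //; first by rewrite fineK.
  split.
  - by rewrite mulrBr mulr1; lra.
  - have : Lf * (1 - n) <= 1 * (1 - n) by lra.
    by rewrite ler_pM2r//; lra.
  - have n1 : 0 < 1 - n by lra.
    have gp : 0 < 1 - g by lra.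
    have -> : Lf = 1 - (1 - m) / (1 - n).
      by rewrite -[Lf](mulfK (lt0r_neq0 n1)) (_ : Lf * (1 - n) = (1 - n) - (1 - m)); [field|]; lra.
    rewrite lerD2l lerN2; apply: ler_wpM2l; first exact: ltW.
    by rewrite lef_pV2 ?posrE//; lra.
have up : (q y - k) * mu <= 1.
  have [q1|q1] := leP (q y - k) 0.
    by apply: (@le_trans _ _ 0) => //; rewrite mulr_le0_ge0// ltW.
  apply: (@ler_of_small _ _ ((q y - k) * (y * mu + k1)) d) => //.
    by apply: mulr_ge0; [exact: ltW|apply: addr_ge0 => //; apply: mulr_ge0; exact: ltW].
  move=> e e0 ed; have [m [Lq [Lf [LqE m0 mB [LqLf Lf1 _]]]]] := main e e0 ed.
  have := le_laplace_q y e e0 (ltW q1); rewrite LqE lee_fin -/k => h.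
  have hm : e * (mu - e * k1) <= 1 - m.
    by move: mB; rewrite ler_distl => /andP[]; rewrite expr2; lra.
  have mk : 0 <= mu - e * k1.
    have := le_trans ed (_ : d <= mu / (k1 + 1)).
    rewrite ge_min lexx orbT => /(_ isT); rewrite ler_pdivlMr//.
    have : 0 <= e by exact: ltW.
    by lra.
  set a := q y - k in q1 h *; set X := expR (- e * y) in h.
  have X0 : 0 <= X by exact: expR_ge0.
  have aX0 : 0 <= a * X by rewrite mulr_ge0// ltW.
  have h1 : a * X <= e * Lq.
    by move: h; rewrite mulrA ler_pdivrMr// (mulrC Lq).
  have h2 : a * X * (1 - m) <= e * Lq * (1 - m) by rewrite ler_wpM2r// ltW.
  have h3 : a * X * (e * (mu - e * k1)) <= a * X * (1 - m) by rewrite ler_wpM2l.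
  have h4 : a * X * (mu - e * k1) <= 1.
    rewrite -(ler_pM2l e0) mulr1; apply: (@le_trans _ _ (e * Lf)).
      by rewrite -LqLf; lra.
    by rewrite ger_pMr.
  have hX : 1 - e * y <= X by have := expR_ge1Dx (- e * y); rewrite /X; lra.
  have h5 : 0 <= a * (mu - e * k1) * (X - (1 - e * y)).
    by rewrite !mulr_ge0//; [exact: ltW|lra].
  have h6 : 0 <= a * (e ^+ 2 * (y * k1)).
    by rewrite !mulr_ge0 ?sqr_ge0// ltW.
  by move: h6; rewrite expr2; lra.
have low : 1 <= (q y + k) * mu.
  have g2 : 0 <= (1 - g)^-1 by rewrite invr_ge0; lra.
  apply: (@ler_of_small _ _ ((mu + k1) * (C + (1 - g)^-1) + (q y + k) * k1) d) => //.
    by rewrite addr_ge0// mulr_ge0// addr_ge0// ltW.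
  move=> e e0 ed; have [m [Lq [Lf [LqE m0 mB [LqLf _ Lf1]]]]] := main e e0 ed.
  have [e1 es] : e <= 1 /\ e <= s / 2.
    by split; apply: (le_trans ed); rewrite !ge_min lexx ?orbT.
  have := laplace_q_le y e y0 e0 es; rewrite LqE lee_fin -/k -/C => h.
  have hm : 1 - m <= e * (mu + e * k1).
    by move: mB; rewrite ler_distl => /andP[_]; rewrite expr2; lra.
  have hm' : 1 - m <= e * (mu + k1).
    apply: (le_trans hm); rewrite ler_wpM2l// ?(ltW e0)// lerD2l.
    by rewrite ler_piMl.
  have h1 : Lf <= (C + (q y + k) / e) * (1 - m) by rewrite -LqLf ler_wpM2r// ltW.
  have h2 : 0 <= (C + (1 - g)^-1) * (e * (mu + k1) - (1 - m)).
    by apply: mulr_ge0; [exact: addr_ge0|lra].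
  have h3 : (q y + k) / e * (1 - m) <= (q y + k) * (mu + e * k1).
    rewrite -mulrA ler_wpM2l ?addr_ge0// mulrC ler_pdivrMr//; lra.
  by lra.
have mV : 0 < mu^-1 by rewrite invr_gt0.
rewrite ler_distl; apply/andP; split.
- by rewrite lerBlDr -[leLHS]mul1r ler_pdivrMr.
- by rewrite -lerBlDr -[leRHS]mul1r ler_pdivlMr.
Qed.

End abel.

(** * Uniform minorization and choice of the constants *)

Section smooth_density.
Context {R : realType}.
Notation leb := (@lebesgue_measure R).

(** A density given by its integrals carries no pointwise sign. On the set where [f < 0] its
    integral is minus that of the negative part, yet [Q] is nonnegative there, so the negative part
    has integral zero. *)
Lemma density_pos_part (Q : probability R R) (f : R -> R) :
  measurable_fun setT f ->
  (forall A, measurable A -> (Q A = \int[leb]_(x in A) (f x)%:E)%E) ->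
  forall A, measurable A -> (Q A = \int[leb]_(x in A) (Num.max (f x) 0)%:E)%E.
Proof.
move=> mf QE A mA.
have mfE : measurable_fun setT (EFin \o f) by exact/measurable_EFinP.
pose N : set R := [set x | f x < 0].
have mN : measurable N.
  rewrite (_ : N = setT `&` f @^-1` `]-oo, 0[%classic); first exact: mf.
  by apply/seteqP; split => x /=; rewrite in_itv/=; [split|case].
have posE x : ((EFin \o f)^\+ x = (Num.max (f x) 0)%:E)%E.
  by rewrite funeposE /= EFin_max.
have intE (B : set R) : (\int[leb]_(x in B) (f x)%:E =
    \int[leb]_(x in B) (EFin \o f)^\+ x - \int[leb]_(x in B) (EFin \o f)^\- x)%E.
  exact: integralE.
have neg0 : (\int[leb]_(x in N) (EFin \o f)^\- x = 0)%E.
  apply/eqP; rewrite eq_le integral_ge0 ?andbT//.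
  rewrite -leeN2 oppe0; have QN : (0 <= Q N)%E by exact: measure_ge0.
  move: QN; rewrite QE//.
  rewrite intE [X in (_ <= X - _)%E]integral0_eq ?sub0e//.
  by move=> x Nx; rewrite posE max_r// ltW.
rewrite QE// intE.
rewrite [X in (_ - X)%E](_ : _ = 0%E) ?sube0; last first.
  apply/eqP; rewrite eq_le integral_ge0 ?andbT//.
  rewrite -[leRHS]neg0 [leRHS]integral_mkcond.
  apply: (@le_trans _ _ (\int[leb]_(x in setT) (EFin \o f)^\- x)%E).
    by apply: ge0_subset_integral => //; exact: measurable_funeneg.
  rewrite le_eqVlt; apply/orP; left; apply/eqP; apply: eq_integral => x _.
  rewrite patchE; case: ifPn => // xN; rewrite funenegE /= max_r//.
  by rewrite lee_fin oppr_le0 leNgt; apply: contra xN => fx; rewrite inE.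
by apply: eq_integral => x _; rewrite posE.
Qed.

(** Rolle provides a zero of the derivative in []-T, T[]; from there the derivative changes by at
    most the integral of the absolute second derivative, so [K] bounds it, and the mean value
    theorem concludes. *)
Lemma C02_lipschitz (T K : R) (f : R -> R) : 0 < T -> C02 T f ->
  (\int[leb]_(x in `[(- T)%R, T]) (`|derive1n 2 f x|)%:E <= K%:E)%E ->
  (forall x y, `|f x - f y| <= K * `|x - y|) /\
  (forall x, T <= `|x| -> f x = 0).
Proof.
move=> T0 [df [ddf [cf2 [S [_ ST Sf]]]]] fK.
have f_out x : T <= `|x| -> f x = 0.
  move=> Tx; apply: Sf => /ST /=; rewrite in_itv/= => /andP[h1 h2].
  by move: Tx; rewrite leNgt ltr_norml h1 h2.
have cf : continuous f by move=> x; apply/differentiable_continuous/derivable1_diffP.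
have cf1 : continuous (derive1 f).
  by move=> x; apply/differentiable_continuous/derivable1_diffP.
have NTT : - T < T by lra.
have [c cT f'c] : exists2 c, c \in `]- T, T[%R & is_derive c 1 f 0.
  apply: Rolle => //; first exact: continuous_subspaceT.
  by rewrite !f_out ?normrN// ger0_norm// ltW.
have f'c0 : derive1 f c = 0 by rewrite derive1E derive_val.
have FTC a b : - T <= a -> a < b -> b <= T -> `|derive1 f b - derive1 f a| <= K.
  move=> Ta ab bT; rewrite -lee_fin.
  have E : (\int[leb]_(x in `[a, b]) (derive1n 2 f x)%:E =
      (derive1 f b)%:E - (derive1 f a)%:E)%E.
    apply: (@continuous_FTC2 _ (derive1n 2 f) (derive1 f) a b ab).
    - by apply: continuous_subspaceT; exact: cf2.
    - split => [x _||]; first exact: ddf.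
      + exact/cvg_at_right_filter/cf1.
      + exact/cvg_at_left_filter/cf1.
    - by move=> x _; rewrite derive1nS derive1n1.
  have mf2 : measurable_fun setT (EFin \o derive1n 2 f).
    by apply/measurable_EFinP; exact: continuous_measurable_fun.
  rewrite -abse_EFin EFinB -E; apply: le_trans fK.
  apply: (le_trans (le_abse_integral _ _ _)) => //; first exact: (measurable_funTS mf2).
  apply: ge0_subset_integral => //.
  - by apply: measurable_funTS; apply: measurableT_comp mf2.
  - by move=> x; rewrite /= !in_itv/= => /andP[h1 h2]; apply/andP; split; lra.
have f'K x : x \in `]- T, T[%R -> `|derive1 f x| <= K.
  rewrite in_itv/= => /andP[x1 x2]; move: cT; rewrite in_itv/= => /andP[c1 c2].
  have [cx|xc|<-] := ltgtP c x.
  - by have := FTC c x (ltW c1) cx (ltW x2); rewrite f'c0 subr0.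
  - by have := FTC x c (ltW x1) xc (ltW c2); rewrite f'c0 sub0r normrN.
  - rewrite f'c0 normr0 -lee_fin; apply: le_trans fK.
    by apply: integral_ge0 => y _; rewrite lee_fin.
split=> //.
have lip x y : - T <= x -> x <= y -> y <= T -> `|f x - f y| <= K * `|x - y|.
  move=> Tx xy yT.
  have [<-|xney] := eqVneq x y; first by rewrite !subrr normr0 mulr0.
  have {xney} xy' : x < y by rewrite lt_neqAle xney.
  have [z zxy fxy] : exists2 z, z \in `]x, y[%R & f y - f x = derive1 f z * (y - x).
    apply: MVT => //; last exact: continuous_subspaceT.
    by move=> z _; rewrite derive1E; exact/derivableP.
  rewrite distrC fxy normrM distrC ler_wpM2r// f'K//.
  by move: zxy; rewrite !in_itv/= => /andP[h1 h2]; apply/andP; split; lra.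
(* The projection on [[-T, T]] is 1-Lipschitz and leaves [f] unchanged, as [f] vanishes from [T] and
   [-T] outwards; it extends the estimate to the whole line. *)
pose cl x := Num.max (- T) (Num.min x T).
have fcl x : f x = f (cl x).
  rewrite /cl; have [xT|Tx] := leP x T.
    have [//|xT'] := leP (- T) x.
    have fT : f (- T) = 0 by rewrite f_out// normrN ger0_norm// ltW.
    by rewrite fT f_out// ler0_norm; lra.
  rewrite max_r; last lra.
  have fT : f T = 0 by rewrite f_out// ger0_norm// ltW.
  by rewrite fT f_out// ger0_norm; lra.
have clE x : [\/ cl x = x /\ - T <= x <= T, cl x = T /\ T <= x | cl x = - T /\ x <= - T].
  rewrite /cl; have [xT|/ltW Tx] := leP x T.
    have [h|/ltW h] := leP (- T) x; first by apply: Or31; split => //; apply/andP; split.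
    by apply: Or33.
  by rewrite max_r; [apply: Or32|lra].
have K0 : 0 <= K.
  rewrite -lee_fin; apply: le_trans fK.
  by apply: integral_ge0 => y _; rewrite lee_fin.
have main x y : x <= y -> `|f x - f y| <= K * `|x - y|.
  move=> xy; rewrite (fcl x) (fcl y).
  have [cx1 cx2 cxy cd] : [/\ - T <= cl x, cl y <= T, cl x <= cl y & cl y - cl x <= y - x].
    by case: (clE x) => -[-> ?]; case: (clE y) => -[-> ?]; split; lra.
  apply: (le_trans (lip _ _ cx1 cxy cx2)).
  by rewrite ler_wpM2l// !ler0_norm; lra.
move=> x y; have [/main//|/ltW /main] := leP x y.
by rewrite distrC (distrC y).
Qed.

End smooth_density.

Section minorization.
Context {R : realType}.
Notation leb := (@lebesgue_measure R).

(** Otherwise the total integral would be at most [2 T / (4 T) = 1 / 2]. *)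
Lemma exists_large_value (T : R) (h : R -> R) : 0 < T -> measurable_fun setT h ->
  (forall x, 0 <= h x) -> (forall x, T <= `|x| -> h x = 0) ->
  (\int[leb]_x (h x)%:E = 1)%E -> exists2 x, `|x| <= T & (4 * T)^-1 <= h x.
Proof.
move=> T0 mh h0 hout h1; apply: contrapT => hno.
have hle x : h x <= (4 * T)^-1.
  rewrite leNgt; apply/negP => hx; apply: hno; exists x; last exact: ltW.
  rewrite leNgt; apply/negP => Tx; move: hx; rewrite hout ?ltW//.
  by apply/negP; rewrite -leNgt invr_ge0; lra.
have : (\int[leb]_x (h x)%:E <= (2^-1)%:E)%E.
  apply: (@le_trans _ _ (\int[leb]_(x in `[(- T)%R, T]) ((4 * T)^-1)%:E)%E).
    rewrite [leRHS]integral_mkcond; apply: ge0_le_integral => //.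
    - by move=> x _; rewrite lee_fin.
    - exact/measurable_EFinP.
    - by apply/(measurable_restrictT _ _).1 => //.
    - move=> x _; rewrite patchE; case: ifPn => [_|]; first by rewrite lee_fin.
      rewrite notin_setE/= in_itv/= => /negP; rewrite -ler_norml -ltNge => Tx.
      by rewrite (hout x (ltW Tx)).
  rewrite integral_cst//= lebesgue_measure_itv/= lte_fin ifT; last lra.
  by rewrite -EFinB -EFinM lee_fin le_eqVlt; apply/orP; left; apply/eqP; field; lra.
by rewrite h1 lee_fin; lra.
Qed.

End minorization.

(** * All estimates for one measure, with constants that do not depend on it *)

Section renewal_estimates.
Context {R : realType}.
Notation leb := (@lebesgue_measure R).

Variables (p : probability R R) (nu : {finite_measure set R -> \bar R}) (phi : R -> R).
Hypothesis mphi : measurable_fun setT phi.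
Hypothesis phi0 : forall x, 0 <= phi x.
Hypothesis pE : forall A, measurable A ->
  (p A = nu A + \int[leb]_(x in A) (phi x)%:E)%E.
Variables (c tau M g T L eta dl x0 : R).
Hypothesis c0 : 0 < c.
Hypothesis pc : c <= pmean p.
Hypothesis tau0 : 0 < tau.
Hypothesis M0 : 0 < M.
Hypothesis pM : (\int[p]_x (expR (tau * `|x|))%:E <= M%:E)%E.
Hypothesis g0 : 0 <= g.
Hypothesis g1 : g < 1.
Hypothesis nug : (nu setT <= g%:E)%E.
Hypothesis T0 : 0 < T.
Hypothesis L0 : 0 <= L.
Hypothesis phiL : forall x, phi x <= L.
Hypothesis phi_out : forall x, T <= `|x| -> phi x = 0.
Hypothesis eta0 : 0 < eta.
Hypothesis dl0 : 0 < dl.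
Hypothesis x0T : `|x0| <= T.
Hypothesis phieta : forall x, x0 - dl <= x < x0 + dl -> eta <= phi x.

Let k1 := 16 / tau ^+ 2 * M.

Variables (beta D e0 s : R).
Hypothesis beta0 : 0 < beta.
Hypothesis betat : beta <= tau / 2.
Hypothesis betac : beta * k1 <= c / 2.
Let b0 := beta * (c / 2).
Let G := expR (beta * (D + dl)).
Let X := expR (beta * D).
Let cap := weight_cap beta dl D.
Hypothesis dlD : dl <= D.
Hypothesis DM : M <= b0 / 2 * X.
Hypothesis e00 : 0 < e0.
Hypothesis e01 : e0 < 1.
Hypothesis e0b : e0 <= b0 / 4.
Hypothesis e0far : 2 * e0 * cap <= b0 / 4 * X.
Hypothesis e0near : 3 * e0 * (cap + G) <= eta * (2 * dl) * G.
Hypothesis s0 : 0 < s.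
Hypothesis st : s <= tau / 2.
Hypothesis sbeta : s <= beta.
Hypothesis se0 : s * (2 / tau) * M <= e0.
Hypothesis sg : g + s * (2 / tau) * M <= (1 + g) / 2.
Hypothesis sT : expR (s * (T + 3 * dl)) <= 1 + e0.

(** [g'] bounds the exponential moments of [nu], [C] and [Cf] give the decay of [phi] and of the
    forcing, [B] the a priori bound, and [Wm] the weight up to distance [1]. None of them, and hence
    not [K], involves [p] or [x0]. *)
Let g' := (1 + g) / 2.
Let C := L * expR (s * T).
Let Cf := C / (1 - g').
Let B := Cf / (s * (c / 2)).
Let Wm := cap + expR beta.
Let K := 2 * Cf / e0 * Wm / (1 - expR (- s)).

Let k10 : 0 <= k1.
Proof. by rewrite mulr_ge0 ?divr_ge0 ?sqr_ge0// ltW. Qed.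

(** The linear term is at least [e * c]; half of it pays for the quadratic error. *)
Let laplace_drift e : 0 < e -> e <= tau / 2 -> e * k1 <= c / 2 ->
  (\int[p]_x (expR (- e * x))%:E <= (1 - e * (c / 2))%:E)%E.
Proof.
move=> e1 et ec; have [] := laplace_taylor p tau M tau0 pM (- e).
  by rewrite normrN ger0_norm// ltW.
move=> m -> ; rewrite sqrrN mulNr opprK -mulrA -/k1 ler_norml.
move=> /andP[_ h]; rewrite lee_fin.
have h1 : e * c <= e * pmean p by rewrite ler_wpM2l// ltW.
have h2 : e * (e * k1) <= e * (c / 2) by rewrite ler_wpM2l// ltW.
by move: h; rewrite expr2 -mulrA; lra.
Qed.

Let nu_exp r : `|r| <= s -> (\int[nu]_x (expR (r * x))%:E <= g'%:E)%E.
Proof.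
move=> rs; apply: (le_trans (exp_moment_le nu s r rs)).
apply: (@le_trans _ _ (g + s * (2 / tau) * M)%:E); last by rewrite lee_fin.
apply: exp_moment_abs_le => //; last exact: ltW.
apply: le_trans pM; apply: (le_integral_sub p nu phi) => //.
by apply/measurable_EFinP; exact: measurable_expRMabs.
Qed.

Let C0 : 0 <= C. Proof. by rewrite mulr_ge0 ?expR_ge0. Qed.

Let g'01 : 0 <= g' < 1.
Proof. by rewrite /g'; have := g0; have := g1 => h1 h2; apply/andP; split; lra. Qed.

Let phiC (r x : R) : `|r| <= s -> phi x <= C * expR (r * x).
Proof.
move=> rs; have [Tx|xT] := leP T `|x|.
  by rewrite phi_out// mulr_ge0 ?expR_ge0.
rewrite /C -mulrA -expRD; apply: (le_trans (phiL x)); rewrite ler_peMr//.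
rewrite -expR0 ler_expR -lerBlDr sub0r.
apply: le_trans (ler_norm _) _; rewrite normrN normrM.
by rewrite ler_pM// ltW.
Qed.

Let Cf0 : 0 <= Cf.
Proof. by rewrite divr_ge0//; have /andP[] := g'01; lra. Qed.

Let sc : s * k1 <= c / 2.
Proof. by apply: le_trans betac; rewrite ler_wpM2r. Qed.

Let B0 : 0 <= B.
Proof. by rewrite divr_ge0// mulr_ge0 ?divr_ge0// ltW. Qed.

Lemma renewal_density_expR_le x :
  (renewal_density p nu phi x <= (B * expR (s * x))%:E)%E.
Proof.
have ps := laplace_drift s s0 st sc.
have m0 : 0 <= 1 - s * (c / 2).
  rewrite -lee_fin; apply: le_trans ps.
  by apply: integral_ge0 => y _; rewrite lee_fin expR_ge0.
have m1 : 1 - s * (c / 2) < 1 by rewrite ltrBlDr ltrDl mulr_gt0 ?divr_gt0.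
have := renewal_density_le p nu phi mphi phi0 s g' (1 - s * (c / 2)) C g'01 C0 nu_exp
  phiC (ltW s0).
rewrite m0 m1 => /(_ isT ps x).
by rewrite (_ : 1 - (1 - s * (c / 2)) = s * (c / 2))//; ring.
Qed.

Definition renewal_fun x : R := fine (renewal_density p nu phi x).

Lemma renewal_funE x : (renewal_fun x)%:E = renewal_density p nu phi x.
Proof.
rewrite fineK// ge0_fin_numE; last exact: renewal_density_ge0.
by rewrite (le_lt_trans (renewal_density_expR_le x))// ltry.
Qed.

Lemma renewal_fun_ge0 x : 0 <= renewal_fun x.
Proof. by apply: fine_ge0; exact: renewal_density_ge0. Qed.

Lemma renewal_fun_le x : renewal_fun x <= B * expR (s * x).
Proof. by rewrite -lee_fin renewal_funE renewal_density_expR_le. Qed.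

Let f x : R := fine (forcing nu phi x).

Let fE x : (f x)%:E = forcing nu phi x.
Proof.
rewrite fineK// ge0_fin_numE; last exact: forcing_ge0.
have ss : `|s| <= s by rewrite ger0_norm// ltW.
by rewrite (le_lt_trans (forcing_le nu phi mphi phi0 s g' C g'01 C0 nu_exp phiC s x ss))// ltry.
Qed.

Let f_le x : f x <= Cf * expR (- s * x).
Proof.
rewrite -lee_fin fE; apply: (forcing_le nu phi mphi phi0 s g' C g'01 C0 nu_exp phiC).
by rewrite normrN ger0_norm// ltW.
Qed.

Let f0 x : 0 <= f x. Proof. by apply: fine_ge0; exact: forcing_ge0. Qed.

Let mq : measurable_fun setT renewal_fun.
Proof.
by apply: measurableT_comp => //; exact: measurable_renewal_density.
Qed.

Let mf : measurable_fun setT f.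
Proof. by apply: measurableT_comp => //; exact: measurable_forcing. Qed.

Let qE y : ((renewal_fun y)%:E = (f y)%:E + \int[p]_z (renewal_fun (y - z))%:E)%E.
Proof.
rewrite renewal_funE renewal_densityE// addeC fE; congr (_ + _)%E.
by apply: eq_integral => z _; rewrite renewal_funE.
Qed.

Let fE' y : ((f y)%:E = (phi y)%:E + \int[nu]_z (f (y - z))%:E)%E.
Proof.
rewrite fE forcingE//; congr (_ + _)%E.
by apply: eq_integral => z _; rewrite fE.
Qed.

Let eta1 : eta * (2 * dl) <= 1.
Proof.
have dl1 := dl0.
rewrite -lee_fin -(@probability_setT _ _ _ p) pE//.
apply: (@le_trans _ _ (\int[leb]_(x in `[(x0 - dl)%R, (x0 + dl)%R[) eta%:E)%E).
  rewrite integral_cst//= lebesgue_measure_itv/= lte_fin ifT; last lra.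
  by rewrite -EFinB -EFinM lee_fin; lra.
rewrite -[leLHS]add0e; apply: leeD => //; rewrite [leLHS]integral_mkcond.
apply: ge0_le_integral => //.
- by move=> x _; rewrite patchE; case: ifP => // _; rewrite lee_fin ltW.
- by apply/(measurable_restrictT _ _).1.
- exact/measurable_EFinP.
- move=> x _; rewrite patchE; case: ifPn => [|_]; last by rewrite lee_fin.
  by rewrite inE/= in_itv/= lee_fin => /phieta.
Qed.

Lemma renewal_fun_dist x : 0 < x -> `|renewal_fun x - (pmean p)^-1| <= K * expR (- s * x).
Proof.
have st' := st; have s1 := s0; have bt := betat; have t1 := tau0.
have b00 : 0 < b0 by rewrite mulr_gt0 ?divr_gt0.
have X0 : 0 < X by exact: expR_gt0.
have e0b' : e0 <= b0 by have := e0b; lra.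
have far : 2 * e0 * cap + M + e0 * X <= b0 * X.
  have : e0 * X <= b0 / 4 * X by rewrite ler_wpM2r// ltW.
  by have := e0far; have := DM; lra.
have contr := coupling_contraction p nu phi renewal_fun f mphi phi0 pE mq renewal_fun_ge0
  f0 qE tau M s beta b0 dl D eta x0 T e0 tau0 pM (ltW s0) beta0 st betat
  (laplace_drift beta beta0 betat betac) dl0 dlD (ltW eta0) eta1 phieta x0T e00
  e0b' se0 sT far e0near.
have K0 : 0 <= K.
  have cap0 : 0 <= cap by exact: weight_cap_ge0.
  rewrite /K divr_ge0//; last by rewrite subr_ge0 -expR0 ler_expR oppr_le0 ltW.
  apply: mulr_ge0; last by rewrite addr_ge0 ?expR_ge0.
  by apply: divr_ge0; [exact: mulr_ge0|exact: ltW].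
have osc y y' : `|renewal_fun y - renewal_fun y'| <= K * expR (- s * Num.min y y').
  apply: (oscillation_le renewal_fun f s beta e0 B Cf (weight beta dl D)) => //.
  - exact: renewal_fun_ge0.
  - by move=> d d0; exact: weight_ge_expR.
  - exact: renewal_fun_le.
  - move=> d /andP[d0 d1]; apply: (le_trans (weight_le _ _ _ _ d d0)) => //.
    by rewrite lerD2l ler_expR ler_piMr// ltW.
apply: (dist_renewal_limit p nu phi renewal_fun f mphi phi0 pE mq renewal_fun_ge0
  mf f0 qE fE' s B K k1 g' (pmean p)) => //.
- by have /andP[] := g'01.
- exact: lt_le_trans pc.
- exact: renewal_fun_le.
- move=> e e1 es; have [] := laplace_taylor p tau M tau0 pM (- e).
    by rewrite normrN ger0_norm; lra.
  move=> m mE mB; exists m => //.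
  move: mB; rewrite sqrrN -mulrA -/k1 -normrN; congr (`|_| <= _); ring.
- by move=> e e1 es; apply: nu_exp; rewrite normrN ger0_norm// ltW.
Qed.

Lemma geom_measure_setT_le : (geom_measure nu setT <= (1 / (1 - g'))%:E)%E.
Proof.
apply: (geom_measure_le nu s g' g'01 nu_exp setT 1 0) => //.
- by rewrite normr0 ltW.
- by move=> x _; rewrite mul0r expR0 mulr1.
Qed.

Lemma geom_measure_tail_le x :
  (geom_measure nu (`]-oo, (- x)%R] `|` `[x, +oo[) <= (2 / (1 - g') * expR (- s * x))%:E)%E.
Proof.
apply: (le_trans (measureU2 _ _ _)) => //.
have -> : 2 / (1 - g') * expR (- s * x) =
    expR (- s * x) / (1 - g') + expR (- s * x) / (1 - g') by ring.
rewrite EFinD; apply: leeD.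
- apply: (geom_measure_le nu s g' g'01 nu_exp _ _ (- s)); rewrite ?expR_ge0//.
    by rewrite normrN ger0_norm// ltW.
  move=> y /=; rewrite in_itv/= => yx; rewrite -expRD -expR0 ler_expR -mulrDr mulNr oppr_ge0.
  by rewrite pmulr_rle0//; lra.
- apply: (geom_measure_le nu s g' g'01 nu_exp _ _ s); rewrite ?expR_ge0//.
    by rewrite ger0_norm// ltW.
  move=> y /=; rewrite in_itv/= andbT => xy; rewrite -expRD -expR0 ler_expR mulNr addrC -mulrBr.
  by rewrite mulr_ge0 ?subr_ge0// ltW.
Qed.

End renewal_estimates.

(** * Choice of the constants *)

Section constants.
Context {R : realType}.

(** The order avoids circularity: [beta] makes the drift beat the quadratic error, [D] makes the
    exponential weight beat [M], then [weight_cap] and [G] are fixed and [e0] is taken small against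
    them, and [s] comes last, small against [e0]. The weight involves neither [e0] nor [s]. *)
Lemma exists_constants (c tau M g T eta dl : R) : 0 < c -> 0 < tau -> 0 < M ->
  0 <= g -> g < 1 -> 0 < T -> 0 < eta -> 0 < dl ->
  exists beta D e0 s : R,
  [/\ [/\ 0 < beta, beta <= tau / 2 & beta * (16 / tau ^+ 2 * M) <= c / 2],
      dl <= D /\ M <= beta * (c / 2) / 2 * expR (beta * D),
      [/\ 0 < e0, e0 < 1, e0 <= beta * (c / 2) / 4,
          2 * e0 * weight_cap beta dl D <= beta * (c / 2) / 4 * expR (beta * D) &
          3 * e0 * (weight_cap beta dl D + expR (beta * (D + dl))) <=
            eta * (2 * dl) * expR (beta * (D + dl))] &
      [/\ 0 < s, s <= beta, s * (2 / tau) * M <= e0,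
          g + s * (2 / tau) * M <= (1 + g) / 2 &
          expR (s * (T + 3 * dl)) <= 1 + e0]].
Proof.
move=> c0 tau0 M0 g0 g1 T0 eta0 dl0.
set k1 := 16 / tau ^+ 2 * M.
have k10 : 0 < k1 by rewrite mulr_gt0// divr_gt0// exprn_gt0.
have [beta [beta0 lb1 lb2]] : exists b, [/\ 0 < b, b <= tau / 2 & b <= c / 2 / k1].
  exists (Num.min (tau / 2) (c / 2 / k1)).
  by split; rewrite ?lt_min ?ge_min ?lexx ?orbT// !divr_gt0.
set b0 := beta * (c / 2).
have b00 : 0 < b0 by rewrite mulr_gt0// divr_gt0.
(* Then [beta * D >= 2 * M / b0], and [t <= exp t] gives [M <= b0 / 2 * exp (beta D)]. *)
set D := dl + 2 * M / (b0 * beta).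
have DM0 : 0 < 2 * M / (b0 * beta) by rewrite divr_gt0 ?mulr_gt0.
set X := expR (beta * D); have X0 : 0 < X by exact: expR_gt0.
set G := expR (beta * (D + dl)); have G0 : 0 < G by exact: expR_gt0.
set cap := weight_cap beta dl D; have cap0 : 0 <= cap by exact: weight_cap_ge0.
set e1 := b0 / 4 * X / (2 * (cap + 1)).
set e2 := eta * (2 * dl) * G / (3 * (cap + G)).
have cap1 : 0 < cap + 1 by lra.
have capG : 0 < cap + G by lra.
have [e0 [e00 [le1 le2 le3 le4]]] : exists e, 0 < e /\
    [/\ e <= 1 / 2, e <= b0 / 4, e <= e1 & e <= e2].
  exists (Num.min (Num.min (1 / 2) (b0 / 4)) (Num.min e1 e2)).
  split; first by rewrite !lt_min !divr_gt0 ?mulr_gt0 ?divr_gt0.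
  by split; rewrite !ge_min lexx ?orbT.
set w := 2 / tau * M; have w0 : 0 < w by rewrite mulr_gt0// divr_gt0.
have ln0 : 0 < ln (1 + e0) by rewrite ln_gt0// ltrDl.
have Tdl : 0 < T + 3 * dl by lra.
have [s [s0 [ls1 ls2 ls3 ls4]]] : exists r, 0 < r /\ [/\ r <= beta, r <= e0 / w,
    r <= (1 - g) / 2 / w & r <= ln (1 + e0) / (T + 3 * dl)].
  exists (Num.min (Num.min beta (e0 / w))
    (Num.min ((1 - g) / 2 / w) (ln (1 + e0) / (T + 3 * dl)))).
  split; first by rewrite !lt_min beta0 !divr_gt0// subr_gt0.
  by split; rewrite !ge_min lexx ?orbT.
exists beta, D, e0, s; split.
- by split => //; rewrite -ler_pdivlMr.
- split; first by rewrite lerDl ltW.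
  have : beta * D <= X by exact: le_expR.
  have : 2 * M / b0 <= beta * D.
    rewrite /D mulrDr (_ : beta * (2 * M / (b0 * beta)) = 2 * M / b0).
      by rewrite lerDr mulr_ge0// ltW.
    by field; rewrite !gt_eqF.
  move=> /le_trans/[apply]; rewrite ler_pdivrMr// => h; rewrite -/b0 -/X; lra.
- split => //; first by lra.
  + move: le3; rewrite /e1 ler_pdivlMr; last by rewrite mulr_gt0.
    by rewrite -/b0 -/X -/cap; lra.
  + move: le4; rewrite /e2 ler_pdivlMr; last by rewrite mulr_gt0.
    by rewrite -/G -/cap; lra.
- rewrite -!(mulrA s) -/w; split => //.
  + by rewrite -ler_pdivlMr.
  + by move: ls3; rewrite ler_pdivlMr//; lra.
  + rewrite -[leRHS]lnK ?posrE//; last lra.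
    by rewrite ler_expR -ler_pdivlMr.
Qed.

End constants.

(* The absolute value makes the scaling total. *)
Definition abs_mscale {R : realType} (l : R) (P : probability R R) :
  {finite_measure set R -> \bar R} := mscale (`|l|)%:nng P.

Lemma abs_mscaleE {R : realType} (l : R) (P : probability R R) (A : set R) :
  0 <= l -> abs_mscale l P A = (l%:E * P A)%E.
Proof. by move=> l0; rewrite /abs_mscale /= /mscale /= ger0_norm. Qed.

Theorem theorem1p1 (R : realType) (Mfam : set (probability R R))
  (lam : probability R R -> R)
  (Phi Psi : probability R R -> probability R R)
  (phi : probability R R -> R -> R) :
  (* (i) inf_p mu_p > 0 *)
  (exists c : R, 0 < c /\ forall p, Mfam p -> c <= pmean p) ->
  (* (ii) sup_p E_p[e^{tau|X|}] < oo for some tau > 0 *)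
  (exists tau : R, 0 < tau /\ exists Mt : R, forall p, Mfam p ->
      (\int[p]_x (expR (tau * `|x|))%:E <= Mt%:E)%E) ->
  (* (iii) mixture decomposition with Phi_p having density phi_p *)
  (forall p, Mfam p ->
     [/\ 0 <= lam p, lam p < 1,
         (forall A, measurable A ->
            p A = ((1 - lam p)%:E * Phi p A + (lam p)%:E * Psi p A)%E) &
         (forall A, measurable A ->
            Phi p A = (\int[lebesgue_measure]_(x in A) (phi p x)%:E)%E)]) ->
  (* (iv) gamma := sup_p lambda_p < 1 *)
  (exists gamma : R, gamma < 1 /\ forall p, Mfam p -> lam p <= gamma) ->
  (* (v) *)
  (exists T : R, 0 < T /\ (forall p, Mfam p -> C02 T (phi p)) /\
     exists K : R, forall p, Mfam p ->
       (\int[lebesgue_measure]_(x in `[(- T)%R, T]) (`|derive1n 2 (phi p) x|)%:E <= K%:E)%E) ->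
  exists (q : probability R R -> R -> R)
         (Nbar : probability R R -> {measure set R -> \bar R}),
    [/\ (forall p, Mfam p -> measurable_fun setT (q p) /\ forall x, 0 <= q p x),
        (forall p, Mfam p -> forall A, measurable A ->
            renewal p A = (\int[lebesgue_measure]_(x in A) (q p x)%:E + Nbar p A)%E),
        (exists B : R, forall p, Mfam p -> (Nbar p setT <= B%:E)%E) &
        exists r0 : R, 0 < r0 /\ forall r : R, 0 < r -> r < r0 ->
          (exists C1 : R, forall p x, Mfam p -> 0 < x ->
              expR (r * x) * `|q p x - (pmean p)^-1| <= C1
              /\ expR (r * x) * q p (- x) <= C1) /\
          (exists C2 : R, forall p x, Mfam p -> 0 < x ->
              ((expR (r * x))%:E * Nbar p (`]-oo, (- x)%R] `|` `[x, +oo[) <= C2%:E)%E)].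
Proof.
move=> [c [c0 pc]] [tau [tau0 [Mt pMt]]] mix [gamma [gamma1 lamg]] [T [T0 [phiC2 [K phiK]]]].
(* The given bounds may have any sign, for instance when the family is empty; the maxima make them
   usable as constants. *)
pose M := Num.max Mt 1; pose g := Num.max gamma 0.
have M0 : 0 < M by rewrite lt_max ltr01 orbT.
have g0 : 0 <= g by rewrite le_max lexx orbT.
have g1 : g < 1 by rewrite gt_max gamma1 ltr01.
pose KK := `|K| + 1; have KK0 : 0 < KK by rewrite ltr_wpDl.
(* The density has a peak of height at least [1 / (4 T)] and loses at most [KK * dl = 1 / (8 T)]
   within distance [dl]; the remaining [1 / (8 T)] times the weight [1 - lam p >= 1 - g] gives
   [eta]. *)
pose dl := (8 * T * KK)^-1; have dl0 : 0 < dl by rewrite invr_gt0 !mulr_gt0.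
pose eta := (1 - g) / (8 * T).
have eta0 : 0 < eta by rewrite divr_gt0 ?subr_gt0 ?mulr_gt0.
pose L := KK * (2 * T).
have L0 : 0 <= L by rewrite !mulr_ge0// ltW.
have [beta [D [e0 [s [[b1 b2 b3] [D1 D2] [e1 e2 e3 e4 e5] [s1 s2 s3 s4 s5]]]]]] :=
  exists_constants c tau M g T eta dl c0 tau0 M0 g0 g1 T0 eta0 dl0.
pose pos p x := Num.max (phi p x) 0.
pose f p x := (1 - lam p) * pos p x.
pose nu p := abs_mscale (lam p) (Psi p).
have pos0 p x : 0 <= pos p x by rewrite le_max lexx orbT.
have lam1 p : Mfam p -> 0 <= 1 - lam p by move=> /mix[_ ? _ _]; lra.
have f0 p x : Mfam p -> 0 <= f p x by move=> /lam1 ?; rewrite mulr_ge0.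
have cphi p : Mfam p -> continuous (phi p).
  by move=> /phiC2[d _] x; apply/differentiable_continuous/derivable1_diffP.
have mphi p : Mfam p -> measurable_fun setT (phi p).
  by move=> /cphi; exact: continuous_measurable_fun.
have mpos p : Mfam p -> measurable_fun setT (pos p).
  by move=> /mphi mp; exact: measurable_maxr.
have mf p : Mfam p -> measurable_fun setT (f p).
  by move=> /mpos mp; exact: measurable_funM.
have PhiE p : Mfam p -> forall A, measurable A ->
    (Phi p A = \int[lebesgue_measure]_(x in A) (pos p x)%:E)%E.
  by move=> Mp; apply: density_pos_part; [exact: mphi|have [] := mix p Mp].
have pE p : Mfam p -> forall A, measurable A ->
    (p A = nu p A + \int[lebesgue_measure]_(x in A) (f p x)%:E)%E.
  move=> Mp A mA; have [l0 l1 pA _] := mix p Mp.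
  rewrite pA// addeC; congr (_ + _)%E.
    by rewrite abs_mscaleE.
  rewrite PhiE// -ge0_integralZl//.
  - by apply/measurable_EFinP; exact: (measurable_funTS (mpos p Mp)).
  - by move=> x _; rewrite lee_fin.
  - by rewrite lee_fin lam1.
have lip p : Mfam p -> (forall x y, `|phi p x - phi p y| <= KK * `|x - y|) /\
    (forall x, T <= `|x| -> phi p x = 0).
  move=> Mp; have [h1 h2] := C02_lipschitz T K (phi p) T0 (phiC2 p Mp) (phiK p Mp).
  split=> // x y; apply: (le_trans (h1 x y)); rewrite ler_wpM2r//.
  by rewrite (le_trans (ler_norm K))// lerDl.
have poslip p x y : Mfam p -> `|pos p x - pos p y| <= KK * `|x - y|.
  move=> /lip[h _]; apply: le_trans (h x y).
  rewrite /pos; case: (leP (phi p x) 0) => h1; case: (leP (phi p y) 0) => h2.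
  - by rewrite subrr normr0.
  - by rewrite sub0r normrN gtr0_norm// ler0_norm; lra.
  - by rewrite subr0 gtr0_norm// ger0_norm; lra.
  - by [].
have pos_out p x : Mfam p -> T <= `|x| -> pos p x = 0.
  by move=> /lip[_ h] Tx; rewrite /pos h// max_r.
have posL p x : Mfam p -> pos p x <= L.
  move=> Mp; have [Tx|xT] := leP T `|x|; first by rewrite pos_out.
  have := poslip p x T Mp; rewrite (pos_out p T Mp) ?subr0 ?(ger0_norm (pos0 _ _)); last first.
    by rewrite ger0_norm// ltW.
  move/le_trans; apply; rewrite ler_wpM2l ?(ltW KK0)//.
  by rewrite (le_trans (ler_normB _ _))// (gtr0_norm T0); lra.
have fL p x : Mfam p -> f p x <= L.
  move=> Mp; apply: le_trans (posL p x Mp); rewrite ler_piMl//.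
  by have [? _ _ _] := mix p Mp; lra.
have f_out p x : Mfam p -> T <= `|x| -> f p x = 0.
  by move=> Mp Tx; rewrite /f pos_out// mulr0.
have pM p : Mfam p -> (\int[p]_x (expR (tau * `|x|))%:E <= M%:E)%E.
  by move=> /pMt h; apply: (le_trans h); rewrite lee_fin le_max lexx.
have nug p : Mfam p -> (nu p setT <= g%:E)%E.
  move=> Mp; have [l0 _ _ _] := mix p Mp.
  rewrite abs_mscaleE// probability_setT mule1 lee_fin.
  by rewrite (le_trans (lamg p Mp))// le_max lexx.
have minor p : Mfam p -> exists2 x0, `|x0| <= T &
    forall x, x0 - dl <= x < x0 + dl -> eta <= f p x.
  move=> Mp.
  have [x0 x0T hx0] : exists2 x, `|x| <= T & (4 * T)^-1 <= pos p x.
    apply: exists_large_value => //; first exact: mpos.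
      by move=> x; exact: pos_out.
    by rewrite -PhiE// probability_setT.
  exists x0 => // x /andP[xa xb].
  have hd : `|x - x0| <= dl by rewrite ler_distl; apply/andP; split; lra.
  have h1 := poslip p x x0 Mp.
  have h2 : KK * `|x - x0| <= (8 * T)^-1.
    apply: (@le_trans _ _ (KK * dl)); first by rewrite ler_wpM2l// ltW.
    rewrite /dl le_eqVlt; apply/orP; left; apply/eqP; field.
    by rewrite !gt_eqF.
  have h3 : (4 * T)^-1 = (8 * T)^-1 + (8 * T)^-1 by field; rewrite gt_eqF.
  have h4 : (8 * T)^-1 <= pos p x.
    by move: h1; rewrite ler_distl => /andP[h1 _]; lra.
  rewrite /eta /f; apply: ler_pM => //.
  - by rewrite subr_ge0 ltW.
  - by rewrite invr_ge0 mulr_ge0// ltW.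
  - by rewrite lerB// le_max lamg.
have st : s <= tau / 2 by exact: le_trans b2.
have qE p (Mp : Mfam p) := @renewal_funE R p (nu p) (f p) (mf p Mp) (fun x => f0 p x Mp)
  (pE p Mp) c tau M g T L c0 (pc p Mp) tau0 M0 (pM p Mp) g0 g1 (nug p Mp) L0
  (fun x => fL p x Mp) (fun x => f_out p x Mp) beta s b3 s1 st s2 s4.
have qle p (Mp : Mfam p) := @renewal_fun_le R p (nu p) (f p) (mf p Mp) (fun x => f0 p x Mp)
  (pE p Mp) c tau M g T L c0 (pc p Mp) tau0 M0 (pM p Mp) g0 g1 (nug p Mp) L0
  (fun x => fL p x Mp) (fun x => f_out p x Mp) beta s b3 s1 st s2 s4.
have Ntot p (Mp : Mfam p) := @geom_measure_setT_le R p (nu p) (f p) (mf p Mp)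
  (fun x => f0 p x Mp) (pE p Mp) tau M g tau0 (pM p Mp) g0 g1 (nug p Mp) s s1 st s4.
have Ntail p (Mp : Mfam p) := @geom_measure_tail_le R p (nu p) (f p) (mf p Mp)
  (fun x => f0 p x Mp) (pE p Mp) tau M g tau0 (pM p Mp) g0 g1 (nug p Mp) s s1 st s4.
(* The constant is quantified before [p], hence before the peak position [x0] which depends on [p]:
   the uniformity of the estimate lies here. *)
have [K1 qdist] : exists K1, forall p, Mfam p -> forall x, 0 < x ->
    `|renewal_fun p (nu p) (f p) x - (pmean p)^-1| <= K1 * expR (- s * x).
  eexists => p Mp; have [x0 x0T x0eta] := minor p Mp.
  exact: (@renewal_fun_dist R p (nu p) (f p) (mf p Mp) (fun x => f0 p x Mp)
    (pE p Mp) c tau M g T L eta dl x0 c0 (pc p Mp) tau0 M0 (pM p Mp) g0 g1 (nug p Mp)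
    L0 (fun x => fL p x Mp) (fun x => f_out p x Mp) eta0 dl0 x0T x0eta beta D e0 s
    b1 b2 b3 D1 D2 e1 e2 e3 e4 e5 s1 st s2 s3 s4 s5).
set B := L * expR (s * T) / (1 - (1 + g) / 2) / (s * (c / 2)) in qle.
set N := (1 - (1 + g) / 2) in Ntot Ntail.
have N0 : 0 < N by rewrite /N; lra.
have decay r x : 0 < x -> r < s -> expR (r * x) * expR (- s * x) <= 1.
  move=> x0 rs; rewrite -expRD -expR0 ler_expR -mulrDl.
  by rewrite pmulr_lle0//; lra.
exists (fun p => renewal_fun p (nu p) (f p)), (fun p => geom_measure (nu p)); split.
- move=> p Mp; split; last by move=> x; apply: renewal_fun_ge0 => y; exact: f0.
  apply: measurableT_comp => //; apply: measurable_renewal_density; first exact: mf.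
  by move=> y; exact: f0.
- move=> p Mp A mA; rewrite (renewalE p (nu p) (f p) (mf p Mp) (fun x => f0 p x Mp) (pE p Mp))//.
  by congr (_ + _)%E; apply: eq_integral => x _; rewrite qE.
- by exists (1 / N).
- exists s; split => // r r0 rs; split.
  + exists (Num.max `|K1| `|B|) => p x Mp x0; split.
    * apply: (@le_trans _ _ (`|K1| * (expR (r * x) * expR (- s * x)))).
        rewrite mulrCA ler_wpM2l ?expR_ge0//; apply: (le_trans (qdist p Mp x x0)).
        by rewrite ler_wpM2r ?expR_ge0// ler_norm.
      by rewrite le_max ler_piMr ?decay.
    (* At [- x] the a priori growth bound [B * exp (s y)] is already the required decay. *)
    * apply: (@le_trans _ _ (`|B| * (expR (r * x) * expR (- s * x)))).
        rewrite mulrCA ler_wpM2l ?expR_ge0//; apply: (le_trans (qle p Mp (- x))).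
        by rewrite mulrN mulNr ler_wpM2r ?expR_ge0// ler_norm.
      by rewrite le_max ler_piMr ?decay ?orbT.
  + exists (2 / N) => p x Mp x0.
    apply: (@le_trans _ _ ((expR (r * x))%:E * (2 / N * expR (- s * x))%:E)%E).
      by apply: lee_wpmul2l; [rewrite lee_fin expR_ge0|exact: Ntail].
    by rewrite -EFinM lee_fin mulrCA ler_piMr ?decay// divr_ge0// ltW.
Qed.
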